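(* If a $Z$-viable semigroup $X$ is ideally $\mathsf{T_{\!z}S}$-closed, then its center $Z(X)$ is projectively $\mathsf{T_{\!1}S}$-closed.
   Context: A topological semigroup is a topological space with a continuous associative operation. $\mathsf{T_{\!1}S}$: $T_1$ topological semigroups; $\mathsf{T_{\!z}S}$: Tychonoff zero-dimensional topological semigroups. For a class $\mathcal C$, a semigroup $S$ (with the discrete topology) is $\mathcal C$-closed if for every isomorphic topological embedding $h:S\to Y$ into $Y\in\mathcal C$, $h[S]$ is closed in $Y$; projectively $\mathcal C$-closed if every quotient semigroup $S/_\approx$ by a congruence is $\mathcal C$-closed; ideally $\mathcal C$-closed if for every ideal $I$ of $S$ (including $\emptyset$) the Rees quotient $S/I$ is $\mathcal C$-closed. $Z(X)$ is the center of $X$. For an idempotent $e$, $H_e$ is the maximal subgroup containing $e$; $e$ is viable if $X\setminus\{x\in X:xe=ex\in H_e\}$ is an ideal of $X$. $X$ is $Z$-viable if every idempotent in $Z(X)$ is viable. *)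

(* Defs.v *)
From HB Require Import structures.
From mathcomp Require Import all_boot all_order all_algebra.
From mathcomp Require Import all_classical all_reals all_analysis.
From mathcomp Require Import Rstruct Rstruct_topology.
From Stdlib Require Import Rdefinitions.

Set Implicit Arguments. Unset Strict Implicit. Unset Printing Implicit Defensive.
Local Open Scope classical_set_scope.

Definition assoc_op (S : Type) (op : S -> S -> S) :=
  forall a b c, op a (op b c) = op (op a b) c.

(** two-sided ideal (the empty set is allowed) *)
Definition is_ideal (S : Type) (op : S -> S -> S) (I : set S) :=
  forall x y, I y -> I (op x y) /\ I (op y x).

Definition congruence (S : Type) (op : S -> S -> S) (E : S -> S -> Prop) :=
  [/\ (forall a, E a a), (forall a b, E a b -> E b a),
      (forall a b c, E a b -> E b c -> E a c) &
      (forall a b c, E a b -> E (op c a) (op c b) /\ E (op a c) (op b c))].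

Definition quot (S : Type) (E : S -> S -> Prop) :=
  {A : set S | exists a, A = E a}.

Definition quot_set (S : Type) (op : S -> S -> S) (E : S -> S -> Prop)
  (A B : set S) : set S :=
  fun c => exists a b, A a /\ B b /\ E (op a b) c.

Lemma quot_setP (S : Type) (op : S -> S -> S) (E : S -> S -> Prop)
  (HE : congruence op E) (A B : quot E) :
  exists c, quot_set op E (proj1_sig A) (proj1_sig B) = E c.
Proof.
case: A => A [a HA]; case: B => B [b HB] /=; subst A B.
case: HE => Er Es Et Ec.
exists (op a b); apply/funext => c; apply/propext; split.
- move=> [a' [b' [Ha [Hb Hc]]]].
  have h1 : E (op a b) (op a' b).
    by have [_ h] := Ec _ _ b Ha.
  have h2 : E (op a' b) (op a' b').
    by have [h _] := Ec _ _ a' Hb.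
  exact: Et (Et _ _ _ h1 h2) Hc.
- by move=> h; exists a, b.
Qed.

Definition quot_mul (S : Type) (op : S -> S -> S) (E : S -> S -> Prop)
  (HE : congruence op E) (A B : quot E) : quot E :=
  exist _ (quot_set op E (proj1_sig A) (proj1_sig B)) (quot_setP HE A B).

(** Rees congruence of an ideal I: I is collapsed to a point
    (for I = set0 this is equality, so S/set0 = S) *)
Definition rees (S : Type) (I : set S) (a b : S) := a = b \/ (I a /\ I b).

Lemma rees_congruence (S : Type) (op : S -> S -> S) (I : set S) :
  is_ideal op I -> congruence op (rees I).
Proof.
move=> HI; split.
- by left.
- by move=> a b [->|[? ?]]; [left|right].
- move=> a b c [->|[Ia Ib]] // [<-|[_ Ic]]; [right|right] => //.
- move=> a b c [->|[Ia Ib]]; first by split; left.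
  split; right; split.
  + by have [h _] := HI c a Ia.
  + by have [h _] := HI c b Ib.
  + by have [_ h] := HI c a Ia.
  + by have [_ h] := HI c b Ib.
Qed.

Definition rees_quot_mul (S : Type) (op : S -> S -> S) (I : set S)
  (HI : is_ideal op I) := quot_mul (rees_congruence HI).

Definition central (X : Type) (op : X -> X -> X) (z : X) :=
  forall x, op z x = op x z.

Definition center (X : Type) (op : X -> X -> X) := {z : X | central op z}.

Lemma central_mul (X : Type) (op : X -> X -> X) (Ha : assoc_op op)
  (z w : center op) : central op (op (proj1_sig z) (proj1_sig w)).
Proof.
case: z => z Hz; case: w => w Hw x /=.
by rewrite -Ha Hw Ha Hz -Ha.
Qed.

Definition center_mul (X : Type) (op : X -> X -> X) (Ha : assoc_op op)
  (z w : center op) : center op :=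
  exist _ (op (proj1_sig z) (proj1_sig w)) (central_mul Ha z w).

(** maximal subgroup H_e containing an idempotent e: the union of all
    subgroups G of X containing e (whose identity is then e) *)
Definition is_subgroup_at (X : Type) (op : X -> X -> X) (e : X) (G : set X) :=
  [/\ G e, (forall g h, G g -> G h -> G (op g h)),
      (forall g, G g -> op e g = g /\ op g e = g) &
      (forall g, G g -> exists h, G h /\ op g h = e /\ op h g = e)].

Definition H_max (X : Type) (op : X -> X -> X) (e : X) : set X :=
  fun x => exists G, is_subgroup_at op e G /\ G x.

Definition viable (X : Type) (op : X -> X -> X) (e : X) :=
  is_ideal op (fun x => ~ (op x e = op e x /\ H_max op e (op x e))).

Definition Z_viable (X : Type) (op : X -> X -> X) :=
  forall e, central op e -> op e e = e -> viable op e.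

Definition top_semigroup (Y : topologicalType) (mul : Y -> Y -> Y) :=
  assoc_op mul /\ continuous (fun p : Y * Y => mul p.1 p.2).

Definition T1_space (Y : topologicalType) := @accessible_space Y.

Definition tychonoff_space (Y : topologicalType) :=
  T1_space Y /\
  forall (B : set Y) (x : Y), closed B -> ~ B x ->
    exists f : Y -> R, continuous f /\ f x = 0%R /\ (forall y, B y -> f y = 1%R).

Definition zero_dim (Y : topologicalType) :=
  forall (x : Y) (U : set Y), open U -> U x ->
    exists V : set Y, clopen V /\ V x /\ V `<=` U.

Definition T1S (Y : topologicalType) (mul : Y -> Y -> Y) :=
  top_semigroup mul /\ T1_space Y.

Definition TzS (Y : topologicalType) (mul : Y -> Y -> Y) :=
  top_semigroup mul /\ tychonoff_space Y /\ zero_dim Y.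

(** h : S -> Y is an isomorphic topological embedding of the discrete
    semigroup S: an injective homomorphism that is a homeomorphism onto
    its image, i.e. whose image is a discrete subspace of Y *)
Definition iso_top_embedding (S : Type) (op : S -> S -> S)
  (Y : topologicalType) (mul : Y -> Y -> Y) (h : S -> Y) :=
  [/\ injective h, (forall a b, h (op a b) = mul (h a) (h b)) &
      (forall s, exists U : set Y, open U /\ U `&` range h = [set h s])].

Definition C_closed (C : forall Y : topologicalType, (Y -> Y -> Y) -> Prop)
  (S : Type) (op : S -> S -> S) :=
  forall (Y : topologicalType) (mul : Y -> Y -> Y), C Y mul ->
  forall h : S -> Y, iso_top_embedding op mul h -> closed (range h).

Definition proj_C_closed (C : forall Y : topologicalType, (Y -> Y -> Y) -> Prop)
  (S : Type) (op : S -> S -> S) :=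
  forall (E : S -> S -> Prop) (HE : congruence op E), C_closed C (quot_mul HE).

Definition ideal_C_closed (C : forall Y : topologicalType, (Y -> Y -> Y) -> Prop)
  (S : Type) (op : S -> S -> S) :=
  forall (I : set S) (HI : is_ideal op I), C_closed C (rees_quot_mul HI).

(* Main.v *)
Require Import Defs.
From HB Require Import structures.
From mathcomp Require Import all_boot all_order all_algebra zify ring lra.
From mathcomp Require Import all_classical all_reals all_analysis.
From mathcomp Require Import Rstruct Rstruct_topology.

(** Two halves meet in a purely algebraic description of the center [Z].

    If [X] is ideally closed, then idempotents of [Z] satisfy both chain
    conditions, [Z] is periodic with maximal subgroups of bounded exponent, and
    only finitely many elements of [Z] lie outside its subgroups. Each failure
    lets one adjoin to a Rees quotient of [X] a limit point of central elements:
    an ultrafilter on an infinite chain of idempotents or on an infinite set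
    with products in the ideal, [lim x ^ n] for [x] of infinite order, a
    Sorgenfrey-like limit of [g] with [chi g] tending to [0] from the right for
    a character [chi] of an unbounded group. Finiteness of the nonregular part
    reduces to null sets by a Ramsey-type argument along an ultrafilter.

    Conversely these properties pass to quotients and imply closedness in any
    T1 topological semigroup: were [y] a limit outside, multiplying [y] by a
    minimal idempotent [f] with [f * y] still outside, one finds that the
    elements near [f * y] have square [g ^ 2] for one [g], so that they lie in a
    single maximal subgroup; but bounded groups are closed. *)

Set Implicit Arguments. Unset Strict Implicit. Unset Printing Implicit Defensive.
Local Open Scope classical_set_scope.

(** * Topologies with a base of clopen sets *)

Definition generated_open (T : Type) (b : set (set T)) : set (set T) :=
  [set U | forall x, U x -> exists B, [/\ b B, B x & B `<=` U]].

(** An alias of [T] whose arguments record the base and its two properties, so that the topology can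
    be attached to the type. *)
Definition base_space (T : Type) (b : set (set T)) (bT : b setT)
  (bI : setI_closed b) : Type := T.

Section BaseSpace.
Context (T : Type) (b : set (set T)) (bT : b setT) (bI : setI_closed b).
Local Notation Y := (base_space bT bI).

Let openT : generated_open b setT.
Proof. by move=> x _; exists setT. Qed.

Let openI : setI_closed (generated_open b).
Proof.
move=> U V oU oV x [Ux Vx].
have [A [bA Ax AU]] := oU x Ux; have [B [bB Bx BV]] := oV x Vx.
by exists (A `&` B); split=> //; [exact: bI | exact: setISS].
Qed.

Let open_bigU (I : Type) (f : I -> set T) :
  (forall i, generated_open b (f i)) -> generated_open b (\bigcup_i f i).
Proof.
move=> fo x [i _ fix_]; have [B [bB Bx Bf]] := fo i x fix_.
by exists B; split=> // z /Bf fz; exists i.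
Qed.

HB.instance Definition _ := gen_eqMixin Y.
HB.instance Definition _ := gen_choiceMixin Y.
HB.instance Definition _ := isOpenTopological.Build Y openT openI open_bigU.

Lemma base_spaceE (U : set Y) : open U = generated_open b U.
Proof. by []. Qed.

Lemma base_open (B : set Y) : b B -> open B.
Proof. by move=> bB; rewrite base_spaceE => x Bx; exists B; split. Qed.

Lemma base_nbhs (x : Y) (U : set Y) :
  nbhs x U -> exists B, [/\ b B, B x & B `<=` U].
Proof.
rewrite nbhsE => -[V [oV Vx] VU].
have [B [bB Bx BV]] := oV x Vx.
by exists B; split=> //; exact: subset_trans VU.
Qed.

Hypothesis bC : forall B, b B -> b (~` B).

Lemma base_clopen (B : set Y) : b B -> clopen B.
Proof.
move=> bB; split; first exact: base_open.
by rewrite -[B]setCK; apply: open_closedC; apply: base_open; exact: bC.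
Qed.

Lemma base_zero_dim : zero_dim Y.
Proof.
move=> x U oU Ux; have [B [bB Bx BU]] := oU x Ux.
by exists B; split=> //; exact: base_clopen.
Qed.

Hypothesis bsep : forall x y, (forall B, b B -> B x -> B y) -> x = y.

Lemma base_T1 : T1_space Y.
Proof.
move=> x y /eqP xy; apply: contrapT => nA; apply: xy.
apply: bsep => B bB Bx; apply: contrapT => nBy; apply: nA.
exists B; split; first exact: base_open.
  by rewrite inE.
by rewrite inE.
Qed.

(** The separating function is the indicator of the complement of a basic clopen set. *)
Lemma base_tychonoff : tychonoff_space Y.
Proof.
split; first exact: base_T1.
move=> B x cB nBx; have oC : open (~` B) by exact: closed_openC.
have [V [bV Vx VB]] := oC x nBx.
pose f (z : Y) : Rdefinitions.R := if pselect (V z) then 0%R else 1%R.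
have fV z : V z -> f z = 0%R by rewrite /f; case: pselect.
have fNV z : ~ V z -> f z = 1%R by rewrite /f; case: pselect.
exists f; split; last first.
  by split=> [|z Bz]; [exact: fV | apply: fNV => /VB].
move=> z; have [Vz|nVz] := pselect (V z).
  have nV : nbhs z V by apply: open_nbhs_nbhs; split=> //; exact: base_open.
  rewrite /continuous_at fV // => W /nbhs_singleton W0.
  by apply: filterS nV => w Vw /=; rewrite fV.
have nV : nbhs z (~` V).
  by apply: open_nbhs_nbhs; split=> //; apply: base_open; exact: bC.
rewrite /continuous_at fNV // => W /nbhs_singleton W1.
by apply: filterS nV => w nVw /=; rewrite fNV.
Qed.

Lemma base_TzS (mul : Y -> Y -> Y) : assoc_op mul ->
  (forall x y B, b B -> B (mul x y) -> exists U V,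
     [/\ b U, b V, U x, V y & forall u v, U u -> V v -> B (mul u v)]) ->
  TzS mul.
Proof.
move=> mulA mulC; split; last by split; [exact: base_tychonoff|exact: base_zero_dim].
split=> // -[x y] W /base_nbhs [B [bB Bxy BW]].
have [U [V [bU bV Ux Vy UVB]]] := mulC x y B bB Bxy.
exists (U, V) => /=.
  by split; apply: open_nbhs_nbhs; split=> //; exact: base_open.
by move=> [u v] /= [Uu Vv]; apply: BW; exact: UVB.
Qed.

(** Every use of ideal closedness passes through this form, in which only basic clopen sets
    appear. *)
Lemma base_closed (S : Type) (op : S -> S -> S) (mul : T -> T -> T)
    (h : S -> T) (y : T) :
  C_closed TzS op -> assoc_op mul ->
  (forall x y B, b B -> B (mul x y) -> exists U V,
     [/\ b U, b V, U x, V y & forall u v, U u -> V v -> B (mul u v)]) ->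
  injective h -> (forall s t, h (op s t) = mul (h s) (h t)) ->
  (forall s, exists B, [/\ b B, B (h s) & forall t, B (h t) -> h t = h s]) ->
  (forall B, b B -> B y -> exists s, B (h s)) -> exists s, h s = y.
Proof.
move=> Scl mulA mulC hI hM hd yh.
have emb : @iso_top_embedding S op Y mul h.
  split=> // s; have [B [bB Bs Bh]] := hd s.
  exists B; split; first exact: base_open.
  rewrite eqEsubset; split=> [z [Bz [t _ tz]]|_ ->].
    by rewrite -tz; apply: Bh; rewrite tz.
  by split=> //; exists s.
have clh := Scl Y mul (base_TzS mulA mulC) h emb.
have [|s _ <-] := clh y; last by exists s.
move=> C /base_nbhs [B [bB By BC]]; have [s Bs] := yh _ bB By.
by exists (h s); split; [exists s | exact: BC].
Qed.

End BaseSpace.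

(** * Adjoining limit points to Rees quotients *)

Section Quotients.
Context (S : Type) (op : S -> S -> S) (E : S -> S -> Prop).
Hypothesis HE : congruence op E.

Definition quot_class (a : S) : quot E := exist _ (E a) (ex_intro _ a erefl).

Lemma quot_classP (c : quot E) : exists a, c = quot_class a.
Proof.
case: c => A cA; have [a Aa] := cA; exists a; exact: eq_exist.
Qed.

Lemma quot_class_eq (a b : S) : quot_class a = quot_class b <-> E a b.
Proof.
have [Er Es Et _] := HE; split=> [[ab]|ab]; first by rewrite ab; exact: Er.
apply: eq_exist => /=; apply/funext => c; apply/propext; split.
  by apply: Et; exact: Es.
exact: Et.
Qed.

Lemma quot_mul_class (a b : S) :
  quot_mul HE (quot_class a) (quot_class b) = quot_class (op a b).
Proof.
have [Er Es Et Ec] := HE; apply: eq_exist => /=.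
apply/funext => c; apply/propext; split=> [[x [y [ax [by_ xyc]]]]|abc]; last first.
  by exists a, b; split; [|split].
refine (Et _ _ _ _ xyc); apply: (Et _ (op x b)).
  exact: (Ec _ _ b ax).2.
exact: (Ec _ _ x by_).1.
Qed.

Lemma quot_mulA : assoc_op op -> assoc_op (quot_mul HE).
Proof.
move=> opA a b c.
have [x ->] := quot_classP a; have [y ->] := quot_classP b.
by have [z ->] := quot_classP c; rewrite !quot_mul_class opA.
Qed.

Definition quot_repr (c : quot E) : S := projT1 (cid (proj2_sig c)).

Lemma quot_reprK (c : quot E) : quot_class (quot_repr c) = c.
Proof.
have [a ->] := quot_classP c; apply: eq_exist => /=.
by rewrite /quot_repr; case: cid => /= b <-.
Qed.

End Quotients.

(** [None] is an external identity; with it the new point itself is the formal product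
    [(None, 1)]. *)
Definition omul (X : Type) (op : X -> X -> X) (a b : option X) : option X :=
  match a, b with
  | Some x, Some y => Some (op x y)
  | None, _ => b
  | _, None => a
  end.

Lemma omulA (X : Type) (op : X -> X -> X) : assoc_op op -> assoc_op (omul op).
Proof. by move=> opA [a|] [b|] [c|] //=; rewrite opA. Qed.

Definition orees (X : Type) (I : set X) : option X -> set (option X) :=
  rees (Some @` I).

(* The pair [(o, k)] stands for the formal product [o * y ^ k] of an element
   of [X] with an identity adjoined and the [k]-th power of a new point [y];
   [nb i p] is the trace on [X] of the [i]-th neighbourhood of [p]. *)
Section AdjoinLimit.
Context (X : Type) (op : X -> X -> X) (opA : assoc_op op).
Context (Xcl : ideal_C_closed TzS op) (I : set X) (HI : is_ideal op I).
Context (Idx : Type) (nb : Idx -> option X * nat -> set (option X)).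

Local Notation pt := (option X * nat)%type.

Definition pmul (p q : pt) : pt := (omul op p.1 q.1, (p.2 + q.2)%N).

Hypothesis Idx_inh : inhabited Idx.
Hypothesis nb_ne : forall i p, nb i p !=set0.
Hypothesis nb_dir : forall i j, exists k, forall p,
  nb k p `<=` nb i p /\ nb k p `<=` nb j p.
Hypothesis nb_dec : forall i p q, exists j,
  nb j q `<=` nb i p \/ nb j q `<=` ~` nb i p.
Hypothesis nb_mul : forall i p q, exists j, forall u v,
  nb j p u -> nb j q v -> nb i (pmul p q) (omul op u v).
Hypothesis nb0 : forall i o, nb i (o, 0%N) = orees I o.
Hypothesis nb_adh : forall i, exists x, nb i (None, 1%N) (Some x).

Let near (p : pt) (P : set (option X)) := exists i, nb i p `<=` P.
(** Traces of clopen sets: near every formal product such a set or its complement holds. By [nb_dec]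
    the sets [nb i p] are of this kind. *)
Let decided (P : set (option X)) := forall p, near p P \/ near p (~` P).

Let nearI p P Q : near p P -> near p Q -> near p (P `&` Q).
Proof.
move=> [i iP] [j jQ]; have [k /(_ p)[ki kj]] := nb_dir i j.
by exists k => z kz; split; [exact/iP/ki | exact/jQ/kj].
Qed.

Let near_ex p P : near p P -> exists z, P z.
Proof. by move=> [i iP]; have [z /iP] := nb_ne i p; exists z. Qed.

Let nearS p P Q : P `<=` Q -> near p P -> near p Q.
Proof. by move=> PQ [i iP]; exists i; exact: subset_trans PQ. Qed.

Let nearC p P : near p P -> near p (~` P) -> False.
Proof. by move=> hP hC; have [z []] := near_ex (nearI hP hC). Qed.

Let decidedC P : decided P -> decided (~` P).
Proof. by move=> dP p; rewrite setCK; case: (dP p); [right|left]. Qed.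

Let decidedI P Q : decided P -> decided Q -> decided (P `&` Q).
Proof.
move=> dP dQ p; case: (dP p) => hP; last first.
  by right; apply: nearS hP => z nPz [].
case: (dQ p) => hQ; first by left; exact: nearI.
by right; apply: nearS hQ => z nPz [].
Qed.

Let decidedT : decided setT.
Proof.
by move=> p; left; have [i] := Idx_inh; exists i.
Qed.

Let decided_nb i p : decided (nb i p).
Proof.
by move=> q; have [j [ji|ji]] := nb_dec i p q; [left|right]; exists j.
Qed.

Let near_mul P U V p q : decided P -> near p U -> near q V ->
  (forall u v, U u -> V v -> P (omul op u v)) -> near (pmul p q) P.
Proof.
move=> dP pU qV UV; case: (dP (pmul p q)) => // -[i iP].
have [j hj] := nb_mul i p q.
have [u [ju Uu]] := near_ex (nearI (ex_intro _ j (@subset_refl _ _)) pU).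
have [v [jv Vv]] := near_ex (nearI (ex_intro _ j (@subset_refl _ _)) qV).
by have /iP := hj _ _ ju jv; have := UV _ _ Uu Vv.
Qed.

Let near_cont P p q : near (pmul p q) P -> exists U V,
  [/\ decided U, decided V, near p U, near q V &
      forall u v, U u -> V v -> P (omul op u v)].
Proof.
move=> [i iP]; have [j hj] := nb_mul i p q.
exists (nb j p), (nb j q); split; try exact: decided_nb.
- by exists j.
- by exists j.
- by move=> u v pu qv; exact/iP/hj.
Qed.

(** Identifying points that no decided set separates makes the space T1, and on elements of [X] it
    induces exactly the Rees congruence. *)
Let indist p q := forall P, decided P -> near p P <-> near q P.

Let indist_congr : congruence pmul indist.
Proof.
split=> [p P _ //|p q pq P dP|p q r pq qr P dP|].
- by split=> /(pq P dP).
- by split=> [/(pq P dP)/(qr P dP)|/(qr P dP)/(pq P dP)].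
suff H p q r P : indist p q -> decided P ->
    (near (pmul r p) P -> near (pmul r q) P) /\
    (near (pmul p r) P -> near (pmul q r) P).
  move=> p q r pq; have qp : indist q p by move=> P dP; split=> /(pq P dP).
  split=> P dP; have [h1 h2] := H p q r P pq dP;
  by have [h3 h4] := H q p r P qp dP.
move=> pq dP; split=> /near_cont[U [V [dU dV hU hV UV]]].
  by have /(pq V dV) hV' := hV; exact: near_mul dP hU hV' UV.
by have /(pq U dU) hU' := hU; exact: near_mul dP hU' hV UV.
Qed.

Let Y := quot indist.
Let cl : pt -> Y := @quot_class _ indist.
Let ball (P : set (option X)) : set Y := [set c | exists2 p, c = cl p & near p P].

Let ballE P p : decided P -> ball P (cl p) <-> near p P.
Proof.
move=> dP; split=> [[q /(quot_class_eq indist_congr)pq]|pP]; last by exists p.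
by move/(pq P dP).
Qed.

Let base : set (set Y) := [set B | exists2 P, decided P & B = ball P].

Let baseT : base setT.
Proof.
exists setT; first exact: decidedT.
apply/seteqP; split=> // c _; have [p ->] := quot_classP c.
apply/ballE; first exact: decidedT.
by case: (decidedT p) => // h; apply: nearS h.
Qed.

Let baseI : setI_closed base.
Proof.
move=> _ _ [P dP ->] [Q dQ ->]; have dPQ := decidedI dP dQ.
exists (P `&` Q) => //; apply/seteqP; split=> c; have [p ->] := quot_classP c.
  by move=> [/(ballE p dP) hP /(ballE p dQ) hQ]; apply/ballE => //; exact: nearI.
move=> /(ballE p dPQ) h; split; apply/ballE => //.
  by apply: nearS h => z [].
by apply: nearS h => z [].
Qed.

Let baseC B : base B -> base (~` B).
Proof.
move=> [P dP ->]; have dC := decidedC dP.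
exists (~` P) => //; apply/seteqP; split=> c; have [p ->] := quot_classP c.
  by move=> h; apply/(ballE p dC); case: (dP p) => // /(ballE p dP).
by move=> /(ballE p dC) h /(ballE p dP) h'; exact: nearC h' h.
Qed.

Let base_sep (c d : Y) : (forall B, base B -> B c -> B d) -> c = d.
Proof.
have [p ->] := quot_classP c; have [q ->] := quot_classP d => h.
have H P : decided P -> near p P -> near q P.
  move=> dP pP; apply/(ballE q dP); apply: h; first by exists P.
  exact/(ballE p dP).
apply/(quot_class_eq indist_congr) => P dP; split; first exact: H.
move=> qP; case: (dP p) => // /(H _ (decidedC dP)) h'.
by case: (nearC qP h').
Qed.

Let mulY := quot_mul indist_congr.

Let mulYA : assoc_op mulY.
Proof.
apply: quot_mulA => -[a k] [b l] [c m]; rewrite /pmul /= addnA.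
by congr pair; exact: omulA.
Qed.

Let base_cont (c d : Y) B : base B -> B (mulY c d) -> exists U V,
  [/\ base U, base V, U c, V d & forall u v, U u -> V v -> B (mulY u v)].
Proof.
move=> [P dP ->]; have [p ->] := quot_classP c; have [q ->] := quot_classP d.
rewrite /mulY quot_mul_class => /(ballE _ dP) /near_cont[U [V [dU dV pU qV UV]]].
exists (ball U), (ball V); split.
- by exists U.
- by exists V.
- exact/ballE.
- exact/ballE.
move=> u v; have [r ->] := quot_classP u; have [s ->] := quot_classP v.
move=> /(ballE _ dU) hU /(ballE _ dV) hV; rewrite quot_mul_class.
by apply/(ballE _ dP); exact: near_mul hU hV UV.
Qed.

Let g (x : X) : Y := cl (Some x, 0%N).

Let near0 P o : near (o, 0%N) P <-> orees I o `<=` P.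
Proof.
split=> [[i]|h]; first by rewrite nb0.
by have [i] := Idx_inh; exists i; rewrite nb0.
Qed.

Let orees_Some x y : orees I (Some x) (Some y) <-> rees I x y.
Proof.
split=> [[[->]|[[u Iu [<-]] [v Iv [<-]]]]|[->|[Ix Iy]]].
- by left.
- by right.
- by left.
- by right; split; [exists x|exists y].
Qed.

Let decided_orees o : decided (orees I o).
Proof.
by have [i] := Idx_inh; rewrite -(nb0 i o); exact: decided_nb.
Qed.

Let orees_sym o o' : orees I o o' -> orees I o' o.
Proof. by case=> [->|[]]; [left|right]. Qed.

Let orees_trans o o' o'' : orees I o o' -> orees I o' o'' -> orees I o o''.
Proof. by case=> [->|[h1 h2]] // [<-|[h3 h4]]; right. Qed.

Let gE x y : g x = g y <-> rees I x y.
Proof.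
rewrite /g (quot_class_eq indist_congr); split=> [h|/orees_Some xy P dP].
  apply/orees_Some/orees_sym.
  have /near0 h2 := (h _ (decided_orees _)).2 ((near0 _ (Some y)).2 (@subset_refl _ _)).
  by apply: h2; left.
split=> /near0 h; apply/near0 => o ho; apply: h.
  exact: orees_trans xy ho.
exact: orees_trans (orees_sym xy) ho.
Qed.

(** Rees classes are decided, so [X / I] is discrete in the new space, and by [nb_adh] the new point
    is adherent to it. Closedness makes the new point a class, which must contain one of its
    neighbourhoods. *)
Lemma adjoin_limit : exists x i, nb i (None, 1%N) `<=` orees I (Some x).
Proof.
pose h (c : quot (rees I)) : Y := g (quot_repr c).
have RE := rees_congruence HI.
have hE x : h (quot_class (rees I) x) = g x.
  by apply/gE/(quot_class_eq RE); rewrite quot_reprK.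
have [c hc] : exists c, h c = cl (None, 1%N).
  apply: (@base_closed Y base baseT baseI baseC base_sep _ (rees_quot_mul HI) mulY
    h (cl (None, 1%N))) => //.
  - move=> c d; have [x ->] := quot_classP c; have [y ->] := quot_classP d.
    by rewrite !hE => /gE/(quot_class_eq RE).
  - move=> c d; have [x ->] := quot_classP c; have [y ->] := quot_classP d.
    by rewrite /rees_quot_mul quot_mul_class !hE /mulY /g quot_mul_class.
  - move=> c; have [x ->] := quot_classP c.
    exists (ball (orees I (Some x))); split.
    + by exists (orees I (Some x)).
    + by rewrite hE; apply/ballE; [exact: decided_orees|exact/near0].
    + move=> d; have [y ->] := quot_classP d.
      rewrite !hE => /(ballE _ (decided_orees (Some x)))/near0 H.
      apply/gE/orees_Some/orees_sym; apply: H; exact: or_introl.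
  - move=> _ [P dP ->] /(ballE _ dP) [i iP].
    have [x ix] := nb_adh i; exists (quot_class _ x); rewrite hE.
    apply/(ballE _ dP); case: (dP (Some x, 0%N)) => // /near0 H.
    by case: (H (Some x)); [left|exact: iP].
exists (quot_repr c).
have /(quot_class_eq indist_congr) H := hc.
have /(H _ (decided_orees _)) : near (Some (quot_repr c), 0%N) (orees I (Some (quot_repr c))).
  exact/near0.
by [].
Qed.

End AdjoinLimit.

Definition oset (X : Type) (I : set X) : set (option X) := Some @` I.

Lemma oset_Some (X : Type) (I : set X) x : oset I (Some x) <-> I x.
Proof. by split=> [[y Iy [<-]]|Ix] //; exists x. Qed.

Lemma oset_None (X : Type) (I : set X) : ~ oset I None.
Proof. by case. Qed.

Lemma oset_ideal (X : Type) (op : X -> X -> X) (I : set X) :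
  is_ideal op I -> is_ideal (omul op) (oset I).
Proof.
move=> HI x y [z Iz <-]; case: x => [x|]; last by split; exists z.
by have [h1 h2] := HI x z Iz; split; [exists (op x z)|exists (op z x)].
Qed.

(** * Idempotent limit points described by a relation *)

Section NoLimit.
Context (X : Type) (op : X -> X -> X) (opA : assoc_op op).
Context (Xcl : ideal_C_closed TzS op) (I : set X) (HI : is_ideal op I).
Context (L : nat -> option X -> option X -> Prop).
Local Notation oI := (oset I).
Local Notation "x * y" := (omul op x y).

Hypothesis L_anti : forall m n z w, (m <= n)%N -> L n z w -> L m z w.
Hypothesis L_out : forall n z w, ~ oI z -> L n z w -> ~ oI w.
Hypothesis L_ne : forall n z, ~ oI z -> exists w, L n z w.
Hypothesis L_sep : forall z w, ~ oI z -> exists n, ~ L n z w.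
Hypothesis L_dec : forall n z z', ~ oI z -> ~ oI z' ->
  exists j, (forall w, L j z' w -> L n z w) \/ (forall w, L j z' w -> ~ L n z w).
Hypothesis L_mul : forall n z z', ~ oI (z * z') -> exists j,
  forall w w', L j z w -> L j z' w' -> L n (z * z') (w * w').
Hypothesis L_mull : forall n z z', ~ oI (z * z') -> exists j,
  forall w, L j z w -> L n (z * z') (w * z').
Hypothesis L_mulr : forall n z z', ~ oI (z * z') -> exists j,
  forall w, L j z' w -> L n (z * z') (z * w).
Hypothesis L_mulI : forall n z z' w w', oI (z * z') ->
  L n z w -> L n z' w' -> oI (w * w').
Hypothesis L_mulIl : forall n z z' w, oI (z * z') -> L n z w -> oI (w * z').
Hypothesis L_mulIr : forall n z z' w, oI (z * z') -> L n z' w -> oI (z * w).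
Hypothesis L_adh : forall n, exists x, L n None (Some x).

(** [L n z] is the trace of a neighbourhood of [z * y]. It does not depend on the exponent of [y]
    once this is positive: the limit is an idempotent. All of [I] is a single point. *)
Let nb n (p : option X * nat) : set (option X) := fun w =>
  (oI p.1 /\ oI w) \/ (~ oI p.1 /\ if p.2 is 0%N then p.1 = w else L n p.1 w).

Let nb_dec n p q : exists j,
  nb j q `<=` nb n p \/ nb j q `<=` ~` nb n p.
Proof.
case: p q => [z k] [z' k'].
have [Iz|Iz] := pselect (oI z); have [Iz'|Iz'] := pselect (oI z').
- by exists 0%N; left=> w [[_ Iw]|[]] //; left.
- exists 0%N; right=> w /= [[]|[_ hw]] // [[_ Iw]|[]] //.
  by case: k' hw Iw => [/= <-|k' /(L_out Iz')].
- exists 0%N; right=> w /= [[_ Iw]|[]] // [[]|[_ hw]] //.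
  by case: k hw Iw => [/= <-|k /(L_out Iz)].
case: k' => [|k'].
  have [nz'|nz'] := pselect (nb n (z, k) z').
    by exists 0%N; left=> w /= [[]|[_ <-]].
  by exists 0%N; right=> w /= [[]|[_ <-]].
case: k => [|k].
  have [j nj] := L_sep z Iz'; exists j; right=> w /= [[]|[_ jw]] // [[]|[_ /= zw]] //.
  by apply: nj; rewrite zw.
have [j [h|h]] := L_dec n Iz Iz'; exists j; [left|right] => w /= [[]|[_ /h jw]] //.
  by right.
by move=> [[]|[]].
Qed.

Let nb_mul n p q : exists j, forall u v,
  nb j p u -> nb j q v -> nb n (pmul op p q) (u * v).
Proof.
have oHI := oset_ideal HI.
case: p q => [z k] [z' k']; rewrite /pmul /nb /=.
have [Izz|Izz] := pselect (oI (z * z')).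
  exists 0%N => u v hu hv; left; split=> //.
  case: hu => [[Iz Iu]|[Iz hu]]; first exact: (oHI v u Iu).2.
  case: hv => [[Iz' Iv]|[Iz' hv]]; first exact: (oHI u v Iv).1.
  case: k hu => [<-|k hu]; case: k' hv => [<-|k' hv] //.
  - exact: L_mulIr Izz hv.
  - exact: L_mulIl Izz hu.
  - exact: L_mulI Izz hu hv.
have Iz : ~ oI z by move=> h; apply: Izz; exact: (oHI z' z h).2.
have Iz' : ~ oI z' by move=> h; apply: Izz; exact: (oHI z z' h).1.
suff [j hj] : exists j, forall u v, (if k is 0%N then z = u else L j z u) ->
    (if k' is 0%N then z' = v else L j z' v) ->
    if (k + k')%N is 0%N then z * z' = u * v else L n (z * z') (u * v).
  exists j => u v [[]|[_ hu]] // [[]|[_ hv]] //; right; split=> //; exact: hj.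
case: k => [|k]; case: k' => [|k'].
- by exists 0%N => u v <- <-.
- by have [j hj] := L_mulr n Izz; exists j => u v <- /hj.
- by have [j hj] := L_mull n Izz; exists j => u v /hj h <-; rewrite addn0.
- by have [j hj] := L_mul n Izz; exists j => u v /hj h /h.
Qed.

(** By [adjoin_limit] a neighbourhood of the limit lies in one Rees class. That class is not [I], by
    [L_out], nor a single point, by [L_sep]. *)
Lemma no_limit : False.
Proof.
have In := @oset_None X I.
have := @adjoin_limit X op opA Xcl I HI nat nb.
case=> //.
- by exists; exact: 0%N.
- move=> n [z k]; have [Iz|Iz] := pselect (oI z); first by exists z; left.
  case: k => [|k]; first by exists z; right.
  by have [w hw] := L_ne n Iz; exists w; right.
- move=> i j; exists (maxn i j) => -[z k].
  case: k => [|k]; first by split=> w [h|[Iz h]]; [left|right|left|right].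
  split=> w [h|[Iz h]]; [by left|right|by left|right]; split=> //.
    by apply: L_anti h; exact: leq_maxl.
  by apply: L_anti h; exact: leq_maxr.
- move=> n z; apply/funext => w; apply/propext; rewrite /nb /orees /rees /=; split.
    by case=> [?|[_ ?]]; [right|left].
  by case=> [zw|?]; [have [Iz|Iz] := pselect (oI z); [left; rewrite -zw|right]|left].
- by move=> n; have [x hx] := L_adh n; exists x; right.
move=> x [i hi]; have [n hn] := L_sep (Some x) In.
have [w hw] := L_ne (maxn i n) In.
have [|xw|[_ Iw]] := hi w; first by right; split=> //; apply: L_anti hw; exact: leq_maxl.
  by apply: hn; rewrite xw; apply: L_anti hw; exact: leq_maxr.
exact: L_out In hw Iw.
Qed.

End NoLimit.

(** * Periodicity of the center *)

(* If no two powers of [x] agree, a new point [lim x ^ n] can be adjoined to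
   [X / I]: each class of the congruence generated by [z ~ x * z] outside [I]
   then receives one limit point. *)
Section Periodic.
Context (X : Type) (op : X -> X -> X) (opA : assoc_op op).
Context (Xcl : ideal_C_closed TzS op) (x : X) (xZ : central op x).
Local Notation "z * w" := (omul op z w).

Let xp n (z : option X) := iter n (omul op (Some x)) z.

Let xpS n z : xp n.+1 z = Some x * xp n z.
Proof. by []. Qed.

Let xpD m n z : xp (m + n) z = xp m (xp n z).
Proof. exact: iterD. Qed.

Let xpC m n z : xp m (xp n z) = xp n (xp m z).
Proof. by rewrite -!xpD addnC. Qed.

Let xpMl n z w : xp n z * w = xp n (z * w).
Proof. by elim: n => [//|n IH]; rewrite !xpS -(omulA opA) IH. Qed.

Let xpMr n z w : z * xp n w = xp n (z * w).
Proof.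
have xz : z * Some x = Some x * z by case: z => //= z; rewrite xZ.
by elim: n => [//|n IH]; rewrite !xpS -IH !(omulA opA) xz.
Qed.

(** The orbit of [z] under multiplication by [x] is eventually periodic. Such elements are
    collapsed; every other orbit is injective. *)
Let J z := exists n k, xp n z = xp (n + k.+1) z.

Let J_eq a b z : a != b -> xp a z = xp b z -> J z.
Proof.
wlog ab : a b / (a < b)%N.
  by move=> H; rewrite neq_ltn => /orP[ab|ba] E; [apply: (H a b)|apply: (H b a)] => //;
    rewrite neq_ltn ?ab ?ba.
by move=> _ E; exists a, (b - a).-1; rewrite prednK ?subn_gt0// subnKC// ltnW.
Qed.

Let xp_inj a b z : ~ J z -> xp a z = xp b z -> a = b.
Proof. by move=> nJ E; apply: contrapT => /eqP ab; exact/nJ/(J_eq ab E). Qed.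

Let J_xp b z : J (xp b z) <-> J z.
Proof.
split=> -[n [k E]]; last by exists n, k; rewrite xpC E xpC.
by exists (n + b)%N, k; rewrite addnAC (xpD n) (xpD (n + _)).
Qed.

Let J_mul z w : J z -> J (z * w).
Proof. by move=> [n [k E]]; exists n, k; rewrite -!xpMl E. Qed.

Let J_mulr z w : J w -> J (z * w).
Proof. by move=> [n [k E]]; exists n, k; rewrite -!xpMr E. Qed.

Let I : set X := [set z | J (Some z)].

Let HI : is_ideal op I.
Proof.
by move=> s z Iz; split;
  [exact: (@J_mulr (Some s) (Some z))|exact: (@J_mul (Some z) (Some s))]. Qed.

(** Up to multiplication by a power of [x], [w] is [x ^ (b - a) * z] with [b - a] at least [n]. *)
Let L n z w := exists a b, (a + n <= b)%N /\ xp a w = xp b z.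

Lemma central_periodic : exists n k,
  iter n (op x) x = iter (n + k.+1) (op x) x.
Proof.
have xpN n : xp n.+1 None = Some (iter n (op x) x).
  by elim: n => //= n ->.
apply: contrapT => aper.
have JN : ~ J None.
  move=> [[|n] [k]]; first by rewrite add0n xpN.
  by rewrite addSn !xpN => -[E]; apply: aper; exists n, k.
have IJ z : oset I z <-> J z.
  case: z => [z|]; first exact: oset_Some.
  by split=> [/oset_None|/JN].
apply: (@no_limit X op opA Xcl I HI L).
- by move=> m n z w mn [a [b [ab E]]]; exists a, b; split=> //; lia.
- move=> n z w; rewrite !IJ => nJ [a [b [_ E]]] Jw; apply: nJ.
  by apply/(J_xp b); rewrite -E; exact/J_xp.
- by move=> n z _; exists (xp n z), 0%N, n.
- move=> z w; rewrite IJ => nJ.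
  (* The difference [b - a] is determined by [z] and [w], because the orbit of [z] is injective; it
     equals [b0 - a0], hence is less than [b0 + 1]. *)
  have [[a0 [b0 E0]]|no] := pselect (exists a b, xp a w = xp b z).
    exists b0.+1 => -[a [b [ab E]]].
    suff : (a0 + b = a + b0)%N by lia.
    by apply: xp_inj nJ _; rewrite !xpD -E -E0 xpC.
  by exists 0%N => -[a [b [_ E]]]; apply: no; exists a, b.
- move=> n z z'; rewrite !IJ => nJ nJ'.
  have [[c [d E0]]|no] := pselect (exists c d, xp c z' = xp d z).
    exists (n + c)%N; left=> w [a [b [ab E]]]; exists (a + c)%N, (b + d)%N.
    by split; [lia|rewrite addnC !xpD E xpC E0].
  exists 0%N; right=> w [a [b [_ E]]] [a' [b' [_ E']]]; apply: no.
  by exists (a' + b)%N, (a + b')%N; rewrite !xpD -E -E' xpC.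
- move=> n z z' _; exists n => w w' [a [b [ab E]]] [a' [b' [ab' E']]].
  exists (a + a')%N, (b + b')%N; split; first by lia.
  by rewrite xpD -xpMr -xpMl E E' xpMl xpMr xpD.
- move=> n z z' _; exists n => w [a [b [ab E]]].
  by exists a, b; rewrite -!xpMl E.
- move=> n z z' _; exists n => w [a [b [ab E]]].
  by exists a, b; rewrite -!xpMr E.
- move=> n z z' w w'; rewrite !IJ => Jz [a [b [_ E]]] [a' [b' [_ E']]].
  apply/(J_xp (a + a')); rewrite xpD -xpMr -xpMl E E' xpMl xpMr.
  by rewrite !J_xp.
- move=> n z z' w; rewrite !IJ => Jz [a [b [_ E]]].
  by apply/(J_xp a); rewrite -xpMl E xpMl J_xp.
- move=> n z z' w; rewrite !IJ => Jz [a [b [_ E]]].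
  by apply/(J_xp a); rewrite -xpMr E xpMr J_xp.
- by move=> n; exists (iter n (op x) x), 0%N, n.+1; rewrite add0n xpN.
Qed.

End Periodic.

(** * Boundedness of central subgroups *)

Section TorsionCharacter.
Import Order.TTheory GRing.Theory Num.Theory.
Context (X : Type) (op : X -> X -> X) (opA : assoc_op op) (e : X).
Hypotheses (eZ : central op e) (eI : op e e = e).

Definition pow_at (n : nat) (g : X) : X := iter n (op g) e.
Local Notation pow := pow_at.

Definition torsion_at (g : X) : Prop :=
  [/\ central op g, op e g = g & exists k, pow k.+1 g = e].
Local Notation G := torsion_at.

Lemma pow_atSr n g : op e g = g -> pow n.+1 g = iter n (op g) g.
Proof. by move=> eg; rewrite /pow_at iterSr -eZ eg. Qed.

Lemma pow_at_id n g : op e g = g -> op e (pow n g) = pow n g.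
Proof.
by move=> eg; elim: n => [|n IH] //; rewrite /pow_at iterS opA eg.
Qed.

Lemma pow_atD m n g : op e g = g -> pow (m + n) g = op (pow m g) (pow n g).
Proof.
move=> eg; elim: m => [|m IH]; first by rewrite add0n -[in LHS]pow_at_id.
by rewrite addSn /pow_at !iterS -/(pow (m + n) g) IH opA.
Qed.

Lemma pow_at1 n : pow n e = e.
Proof. by elim: n => // n IH; rewrite /pow_at iterS -/(pow n e) IH. Qed.

Lemma pow_atM m n g : op e g = g -> pow (m * n) g = pow n (pow m g).
Proof.
move=> eg; elim: n => [|n IH]; first by rewrite muln0.
by rewrite mulnS pow_atD // IH.
Qed.

Lemma pow_at_central n g : central op g -> central op (pow n g).
Proof.
move=> gZ; elim: n => // n IH x.
by rewrite /pow_at iterS -/(pow n g) -opA IH opA gZ -opA.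
Qed.

Lemma pow_at_mul n g h : op e g = g -> central op h ->
  pow n (op g h) = op (pow n g) (pow n h).
Proof.
move=> eg hZ; elim: n => [|n IH]; first by rewrite eI.
rewrite /pow_at !iterS -!/(pow n _) IH -!opA; congr (op g _).
by rewrite !opA; congr (op _ _); rewrite hZ.
Qed.

Lemma torsion_at_e : G e.
Proof. by split=> //; exists 0%N; rewrite pow_at1. Qed.

Lemma torsion_at_mul g h : G g -> G h -> G (op g h).
Proof.
move=> [gZ eg [k gk]] [hZ eh [l hl]]; split.
- by move=> x; rewrite -opA hZ opA gZ -!opA.
- by rewrite opA eg.
exists (k.+1 * l.+1).-1; rewrite prednK ?muln_gt0// pow_at_mul//.
by rewrite pow_atM// gk pow_at1 mulnC pow_atM// hl pow_at1.
Qed.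

Lemma torsion_at_pow n g : G g -> G (pow n g).
Proof.
move=> Gg; elim: n => [|n IH]; first exact: torsion_at_e.
exact: torsion_at_mul.
Qed.

(* [P g t] reads "the character takes the value [t] mod 1 at [g]". *)
Record partial_character (P : X -> rat -> Prop) : Prop := PartialCharacter {
  pchar_dom : forall g t, P g t -> G g;
  pchar_int : forall z : int, P e z%:~R%R;
  pchar_mul : forall g h s t, P g s -> P h t -> P (op g h) (s + t)%R;
  pchar_e : forall t, P e t -> t \is a Num.int
}.

Lemma pchar_pow P n g t : partial_character P -> P g t ->
  P (pow n g) (n%:R * t)%R.
Proof.
move=> cP Pg; elim: n => [|n IH]; first by rewrite mul0r; exact: (pchar_int cP 0).
by rewrite /pow_at iterS mulrS mulrDl mul1r; exact: (pchar_mul cP).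
Qed.

Lemma pchar_shift P g t (z : int) : partial_character P -> P g t ->
  P g (t + z%:~R)%R.
Proof.
move=> cP Pg; have [gZ eg _] := pchar_dom cP Pg.
by rewrite -eg eZ; apply: (pchar_mul cP) => //; exact: (pchar_int cP).
Qed.

Lemma pchar_inj P g s t : partial_character P -> P g s -> P g t ->
  (s - t)%R \is a Num.int.
Proof.
move=> cP Ps Pt; have [gZ eg [k gk]] := pchar_dom cP Ps.
have := pchar_mul cP Ps (pchar_pow k cP Pt); rewrite -[op g (pow k g)]/(pow k.+1 g) gk.
move=> /(pchar_e cP) h1; have := pchar_pow k.+1 cP Pt; rewrite gk => /(pchar_e cP) h2.
have -> : (s - t = s + k%:R * t - k.+1%:R * t)%R by rewrite mulrS; ring.
exact: rpredB.
Qed.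

Hypothesis unbounded : forall n, exists g, G g /\ pow n.+1 g <> e.

(** If [a] has order [m] modulo the domain, its value may be any [m]-th part of a value of [a ^ m],
    hence is small when [m] is large. The extended domain is again of bounded exponent, so that the
    construction can be repeated. *)
Lemma pchar_extend (P : X -> rat -> Prop) (N : nat) :
  partial_character P -> (exists d, forall g t, P g t -> pow d.+1 g = e) ->
  exists Q, [/\ partial_character Q,
    (exists d, forall g t, Q g t -> pow d.+1 g = e),
    (forall g t, P g t -> Q g t) &
    exists a t, [/\ Q a t, (0 < t)%R & (t <= N.+1%:R^-1)%R]].
Proof.
move=> cP [d dP].
pose D g := exists t, P g t.
have Dmul g h : D g -> D h -> D (op g h).
  by move=> [s Pg] [t Ph]; exists (s + t)%R; exact: (pchar_mul cP).
have Dpow n g : D g -> D (pow n g).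
  by move=> [t Pg]; exists (n%:R * t)%R; exact: pchar_pow.
have Dinv g h : G h -> D g -> D (op g h) -> D h.
  move=> [hZ eh _] [s Pg] Dgh; have [gZ eg _] := pchar_dom cP Pg.
  have -> : h = op (pow d g) (op g h).
    have gd : op (pow d g) g = e by rewrite (pow_at_central d gZ) -[RHS](dP g s Pg).
    by rewrite opA gd eh.
  by apply: Dmul => //; apply: Dpow; exists s.
have [a [Ga aD]] : exists a, G a /\ forall j, (0 < j <= N.+1)%N -> ~ D (pow j a).
  (* Otherwise each element has a power with positive exponent at most [N + 1] in the domain, and
     the exponent [(N + 1)! * (d + 1)] kills the whole group. *)
  apply: contrapT => na; have [a [Ga]] := unbounded ((N.+1)`! * d.+1).-1.
  rewrite prednK ?muln_gt0 ?fact_gt0//; have [aZ ea _] := Ga; apply.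
  have [j [j0 [t Pj]]] : exists j, (0 < j <= N.+1)%N /\ D (pow j a).
    apply: contrapT => nj; apply: na; exists a; split=> // j hj Dj; apply: nj.
    by exists j.
  have /dvdnP[q ->] : (j %| (N.+1)`!)%N by rewrite dvdn_fact.
  rewrite -mulnA mulnCA pow_atM// mulnC pow_atM ?pow_at_id// (dP _ _ Pj).
  exact: pow_at1.
have [aZ ea [K aK]] := Ga.
have De : D e by exists 0%R; exact: (pchar_int cP 0).
have exm : exists m, (0 < m)%N && `[< D (pow m a) >].
  by exists K.+1; rewrite aK; apply/asboolP.
case: (ex_minnP exm) => m /andP[m0 /asboolP[u0 Pu0]] mmin.
have mN : (N.+1 < m)%N.
  by rewrite ltnNge; apply/negP => mN; apply: (aD m); [rewrite m0|exists u0].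
(* The representative of the value in [(0, 1]], so that [u / m] is positive. *)
pose u := (u0 + (1 - Num.ceil u0)%:~R)%R.
have Pu : P (pow m a) u by exact: pchar_shift.
have u_gt0 : (0 < u)%R.
  by rewrite /u intrB; have := ceilB1_lt u0; lra.
have u_le1 : (u <= 1)%R.
  by rewrite /u intrB; have := ceil_ge u0; lra.
pose t := (u / m%:R)%R.
have m_gt0 : (0 < m%:R :> rat)%R by rewrite ltr0n.
have mt : (m%:R * t = u)%R by rewrite /t mulrC divfK// gt_eqF.
(* Consistency of the extension: a relation between [a] and the domain involves a power of [a] in
   the domain, hence a power of [a ^ m]. *)
have Pa h r k : P h r -> op h (pow k a) = e -> (r + k%:R * t)%R \is a Num.int.
  move=> Ph E; have Dk : D (pow k a).
    apply: (Dinv h); [exact: torsion_at_pow|by exists r|by rewrite E].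
  have /dvdnP[q kq] : (m %| k)%N.
    rewrite /dvdn; apply: contrapT => /negP; rewrite -lt0n => km.
    have := ltn_pmod k m0; rewrite ltnNge => /negP; apply; apply: mmin.
    rewrite km; apply/asboolP; apply: (Dinv (pow (k %/ m * m) a)).
    - exact: torsion_at_pow.
    - by rewrite mulnC pow_atM//; apply: Dpow; exists u.
    - by rewrite -pow_atD// -divn_eq.
  have := pchar_mul cP Ph (pchar_pow q cP Pu).
  rewrite -pow_atM// mulnC -kq E => /(pchar_e cP).
  by rewrite kq natrM -mulrA mt.
pose Q g s := exists h r k, [/\ P h r, g = op h (pow k a) & s = (r + k%:R * t)%R].
have PQ g s : P g s -> Q g s.
  move=> Pg; exists g, s, 0%N; split=> //; last by rewrite mul0r addr0.
  by have [_ eg _] := pchar_dom cP Pg; rewrite -eZ.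
exists Q; split=> //.
- split.
  + move=> _ _ [h [r [k [Ph -> _]]]]; apply: torsion_at_mul.
      exact: pchar_dom Ph.
    exact: torsion_at_pow.
  + by move=> z; apply: PQ; exact: (pchar_int cP).
  + move=> _ _ _ _ [h [r [k [Ph -> ->]]]] [h' [r' [k' [Ph' -> ->]]]].
    exists (op h h'), (r + r')%R, (k + k')%N; split.
    * exact: (pchar_mul cP).
    * rewrite pow_atD// -!opA; congr (op h _); rewrite !opA; congr (op _ _).
      exact: pow_at_central.
    * by rewrite natrD; ring.
  + by move=> _ [h [r [k [Ph E ->]]]]; apply: Pa Ph _.
- exists (d.+1 * K.+1).-1 => _ _ [h [r [k [Ph -> _]]]].
  have [hZ eh _] := pchar_dom cP Ph.
  rewrite prednK ?muln_gt0// pow_at_mul//; last exact: pow_at_central.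
  have -> : pow (d.+1 * K.+1) h = e by rewrite pow_atM// (dP _ _ Ph) pow_at1.
  by rewrite -pow_atM// mulnA mulnC pow_atM// aK pow_at1.
exists a, t; split.
- exists e, 0%R, 1%N; split.
  + exact: (pchar_int cP 0).
  + by rewrite /pow_at /= -eZ ea.
  + by rewrite mul1r add0r.
- by rewrite divr_gt0.
- rewrite /t ler_pdivrMr// (le_trans u_le1)//.
  by rewrite mulrC ler_pdivlMr ?ltr0n// mul1r ler_nat ltnW.
Qed.

(** The union of a chain of extensions that starts with the trivial character, stage [N] supplying a
    value in [(0, 1 / (N + 1)]]. *)
Lemma small_character : exists P, partial_character P /\
  forall N, exists a t, [/\ P a t, (0 < t)%R & (t <= N.+1%:R^-1)%R].
Proof.
pose good (P : X -> rat -> Prop) := partial_character P /\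
  exists d, forall g t, P g t -> pow d.+1 g = e.
have good0 : good (fun g t => g = e /\ t \is a Num.int).
  split; last by exists 0%N => g t [-> _]; exact: pow_at1.
  split.
  - by move=> g t [-> _]; exact: torsion_at_e.
  - by move=> z; split=> //; exact: intr_int.
  - by move=> g h s t [-> s_int] [-> t_int]; split=> //; exact: rpredD.
  - by move=> t [].
have step N (P : {P | good P}) : exists Q : {Q | good Q},
    (forall g t, proj1_sig P g t -> proj1_sig Q g t) /\
    exists a t, [/\ proj1_sig Q a t, (0 < t)%R & (t <= N.+1%:R^-1)%R].
  have [cP dP] := proj2_sig P; have [Q [cQ dQ PQ hQ]] := pchar_extend N cP dP.
  by exists (exist _ Q (conj cQ dQ)).
pose next N P := projT1 (cid (step N P)).
pose fix S n := if n is n'.+1 then next n' (S n') else exist _ _ good0.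
have SS n g t : proj1_sig (S n) g t -> proj1_sig (S n.+1) g t.
  by rewrite /= /next; case: cid => /= Q [PQ _] /PQ.
have Smono m n g t : (m <= n)%N -> proj1_sig (S m) g t -> proj1_sig (S n) g t.
  by move/subnKC <-; elim: (n - m)%N => [|k IH]; rewrite ?addn0// addnS => /IH/SS.
exists (fun g t => exists n, proj1_sig (S n) g t); split; last first.
  move=> N; have [_ [a [t [Qa t0 tN]]]] := projT2 (cid (step N (S N))).
  by exists a, t; split=> //; exists N.+1.
split.
- by move=> g t [n]; have [cP _] := proj2_sig (S n); exact: pchar_dom.
- by move=> z; exists 0%N; split=> //; exact: intr_int.
- move=> g h s t [m hm] [n hn]; exists (maxn m n).
  have [cP _] := proj2_sig (S (maxn m n)); apply: (pchar_mul cP).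
    by apply: Smono hm; exact: leq_maxl.
  by apply: Smono hn; exact: leq_maxr.
- by move=> t [n]; have [cP _] := proj2_sig (S n); exact: pchar_e.
Qed.

End TorsionCharacter.

(* The new points are the cosets [z * ker chi] of a character [chi] with values
   in Q/Z and infinite range; their neighbourhoods are those of the Sorgenfrey
   topology, [z * {g | 0 < chi g < eps}]: on these intervals addition is
   continuous, while [z] itself is never within them. *)
Section Bounded.
Import Order.TTheory GRing.Theory Num.Theory.
Context (X : Type) (op : X -> X -> X) (opA : assoc_op op).
Context (Xcl : ideal_C_closed TzS op).
Context (e : X) (eZ : central op e) (eI : op e e = e).
Context (P : X -> rat -> Prop) (cP : partial_character op e P).
Hypothesis Psmall :
  forall N, exists a t, [/\ P a t, (0 < t)%R & (t <= N.+1%:R^-1)%R].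
Local Notation "z * w" := (omul op z w).

Let D g := exists t, P g t.

Let DZ g : D g -> central op g.
Proof. by move=> [t Pg]; case: (pchar_dom cP Pg). Qed.

Let De g : D g -> op e g = g.
Proof. by move=> [t Pg]; case: (pchar_dom cP Pg). Qed.

Let D1 : D e.
Proof. by exists 0%R; exact: (pchar_int cP 0). Qed.

Let DM g h : D g -> D h -> D (op g h).
Proof. by move=> [s Pg] [t Ph]; exists (s + t)%R; exact: (pchar_mul cP). Qed.

Let DV g : D g -> exists h, D h /\ op g h = e.
Proof.
move=> [t Pg]; have [gZ eg [k gk]] := pchar_dom cP Pg.
by exists (pow_at op e k g); split=> //; exists (k%:R * t)%R; exact: pchar_pow.
Qed.

Let oZ g z : D g -> z * Some g = Some g * z.
Proof. by case: z => // z /DZ gZ /=; rewrite gZ. Qed.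

Let mulDD z g h : z * Some g * Some h = z * Some (op g h).
Proof. by rewrite -(omulA opA). Qed.

Let mulAC z g w : D g -> z * Some g * w = z * w * Some g.
Proof. by move=> Dg; rewrite -!(omulA opA) -oZ. Qed.

(** The elements on which [D] does not act freely are collapsed; for the others [z * g] determines
    [g], and so its value modulo 1. *)
Let J z := exists g h, [/\ D g, D h, g <> h & z * Some g = z * Some h].

Let J_g g z : D g -> J (z * Some g) -> J z.
Proof.
move=> Dg [h [h' [Dh Dh' hh']]]; rewrite !mulDD => E.
exists (op g h), (op g h'); split=> //; try exact: DM.
move=> gE; apply: hh'; have [k [Dk gk]] := DV Dg.
by rewrite -(De Dh) -(De Dh') -gk (DZ Dg) -!opA gE.
Qed.

Let J_mull z w : J z -> J (z * w).
Proof.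
by move=> [g [h [Dg Dh gh E]]]; exists g, h; split=> //; rewrite -!mulAC// E.
Qed.

Let J_mulr z w : J w -> J (z * w).
Proof.
by move=> [g [h [Dg Dh gh E]]]; exists g, h; split=> //; rewrite -!(omulA opA) E.
Qed.

Let J_inj z g h : ~ J z -> D g -> D h -> z * Some g = z * Some h -> g = h.
Proof. by move=> nJ Dg Dh E; apply: contrapT => gh; apply: nJ; exists g, h. Qed.

Let pchar_lt z g h s t : ~ J z -> P g s -> P h t -> z * Some g = z * Some h ->
  (s < t)%R -> (t < s + 1)%R -> False.
Proof.
move=> nJ Pg Ph /(J_inj nJ (ex_intro _ s Pg) (ex_intro _ t Ph)) gh st ts.
move: Ph; rewrite -gh => /(pchar_inj cP)/(_ Pg)/intrP[k ks].
have : (0 < k%:~R :> rat)%R by lra.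
have : (k%:~R < 1 :> rat)%R by lra.
by rewrite ltr0z ltrz1; lia.
Qed.

Let I : set X := [set z | J (Some z)].

Let HI : is_ideal op I.
Proof.
by move=> s z Iz; split;
  [exact: (@J_mulr (Some s) (Some z))|exact: (@J_mull (Some z) (Some s))]. Qed.

Let L n z w := exists g t,
  [/\ P g t, (0 < t)%R, (t < n.+1%:R^-1)%R & w * Some e = z * Some g].

Let archi (t : rat) : (0 < t)%R -> exists n, (n.+1%:R^-1 < t)%R.
Proof.
move=> t0; exists (Num.bound t^-1); rewrite invf_plt ?posrE ?ltr0n//.
have := archi_boundP (ltW (_ : 0 < t^-1)%R); rewrite invr_gt0 => /(_ t0) /lt_le_trans.
by apply; rewrite ler_nat.
Qed.

Let PD g t : P g t -> D g.
Proof. by exists t. Qed.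

Lemma small_character_contra : False.
Proof.
have JN : ~ J None by move=> [g [h [_ _ gh [/gh]]]].
have IJ z : oset I z <-> J z.
  case: z => [z|]; first exact: oset_Some.
  by split=> [/oset_None|/JN].
have Psmall' n : exists a t, [/\ P a t, (0 < t)%R & (t < n.+1%:R^-1)%R].
  have [a [t [Pa t0 tN]]] := Psmall n.+1; exists a, t; split=> //.
  apply: le_lt_trans tN _; rewrite ltf_pV2 ?posrE ?ltr0n//.
  by rewrite ltr_nat.
have Lmul z g w g' z' w' : D g -> w * Some e = z * Some g ->
    w' * Some e = z' * Some g' -> w * w' * Some e = z * z' * Some (op g g').
  move=> Dg E E'; have -> : w * w' * Some e = w * Some e * (w' * Some e).
    by rewrite (mulAC _ _ D1) (omulA opA) mulDD eI.
  by rewrite E E' (mulAC _ _ Dg) (omulA opA) mulDD (DZ Dg).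
have J_eq z w g : D g -> w * Some e = z * Some g -> J z -> J w.
  by move=> Dg E Jz; apply: (J_g D1); rewrite E; exact: J_mull.
apply: (@no_limit X op opA Xcl I HI L).
- move=> m n z w mn [g [t [Pg t0 tn E]]]; exists g, t; split=> //.
  apply: lt_le_trans tn _.
  by rewrite lef_pV2 ?posrE ?ltr0n// ler_nat.
- move=> n z w; rewrite !IJ => nJ [g [t [Pg _ _ E]]] Jw; apply: nJ.
  by apply: (J_g (PD Pg)); rewrite -E; exact: J_mull.
- move=> n z _; have [a [t [Pa t0 tn]]] := Psmall' n.
  exists (z * Some a), a, t; split=> //; rewrite mulDD.
  by rewrite -eZ (De (PD Pa)).
- move=> z w; rewrite IJ => nJ; apply: contrapT => /forallNP all.
  have [g [t [Pg t0 _ E]]] := contrapT (all 0%N).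
  have [n nt] := archi t0; have [h [s [Ph s0 sn E']]] := contrapT (all n).
  (* As [z] is outside [J], the elements [g1] and [h1] agree, yet their values satisfy
     [0 < r < s1 < 1]. *)
  have [g1 [s1 [Pg1 s10 s1n E1]]] := contrapT (all 0%N).
  have [m mt] := archi s10; have [h1 [r [Ph1 r0 rm E2]]] := contrapT (all m).
  apply: (pchar_lt nJ Ph1 Pg1); first by rewrite -E2.
    exact: lt_trans rm mt.
  by move: s1n; rewrite invr1; lra.
- move=> n z z'; rewrite !IJ => nJ nJ'.
  have [[g0 [[t1 Pg1] E0]]|no] := pselect (exists g, D g /\ z' * Some e = z * Some g); last first.
    exists 0%N; right=> w [g [t [Pg _ _ E]]] [h [s [Ph _ _ E']]]; apply: no.
    have [k [Dk gk]] := DV (PD Pg); exists (op h k); split.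
      exact: DM (PD Ph) Dk.
    by rewrite -mulDD -E' E mulDD gk.
  (* With the value of [g0] taken in [[0, 1)], a short interval to its right lies in
     [(0, 1 / (n + 1))] if [t0] is below the right end, and otherwise misses it without reaching 1.
     This is why half-open intervals are clopen. *)
  pose t0 := (t1 + (- Num.floor t1)%:~R)%R.
  have Pg0 : P g0 t0 by exact: pchar_shift.
  have t0_ge0 : (0 <= t0)%R by rewrite /t0 mulrNz; have := floor_le_tmp t1; lra.
  have t0_lt1 : (t0 < 1)%R.
    by rewrite /t0 mulrNz; have := floorD1_gt t1; rewrite intrD; lra.
  have comp w g : D g -> w * Some e = z' * Some g -> w * Some e = z * Some (op g0 g).
    by move=> Dg ->; rewrite -{1}(De Dg) -!mulDD E0.
  have [t0n|nt0] := ltP t0 n.+1%:R^-1%R.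
    have [j jt] : exists j, (j.+1%:R^-1 < n.+1%:R^-1 - t0)%R by apply: archi; rewrite subr_gt0.
    exists j; left=> w [g [t [Pg t_gt0 tj E]]].
    exists (op g0 g), (t0 + t)%R; split; [exact: (pchar_mul cP)|lra| |].
      by rewrite -ltrBrDl; exact: lt_trans tj jt.
    exact: comp (PD Pg) E.
  have [j jt] : exists j, (j.+1%:R^-1 < 1 - t0)%R by apply: archi; rewrite subr_gt0.
  exists j; right=> w [g [t [Pg t_gt0 tj E]]] [h [s [Ph s_gt0 sn E']]].
  have t1_lt : (t0 + t < 1)%R by rewrite -ltrBrDl; exact: lt_trans tj jt.
  have s_lt : (s < t0)%R by exact: lt_le_trans sn nt0.
  apply: (pchar_lt nJ Ph (pchar_mul cP Pg0 Pg)); [|lra|lra].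
  by rewrite -E'; exact: comp (PD Pg) E.
- move=> n z z' _; exists (n.*2.+1)%N => w w' [g [t [Pg t0 tj E]]] [h [s [Ph s0 sj E']]].
  exists (op g h), (t + s)%R; split; [exact: (pchar_mul cP)|lra| |exact: Lmul (PD Pg) E E'].
  have jn : (n.*2.+2%:R^-1 + n.*2.+2%:R^-1 = n.+1%:R^-1 :> rat)%R.
    rewrite -doubleS -mul2n natrM.
    have n0 : (n.+1%:R != 0 :> rat)%R by rewrite pnatr_eq0.
    by field.
  by rewrite -jn; apply: ltrD.
- move=> n z z' _; exists n => w [g [t [Pg t0 tj E]]].
  by exists g, t; split=> //; rewrite -mulAC// E mulAC//; exact: PD Pg.
- move=> n z z' _; exists n => w [g [t [Pg t0 tj E]]].
  by exists g, t; split=> //; rewrite -!(omulA opA) E.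
- move=> n z z' w w'; rewrite !IJ => Jz [g [t [Pg _ _ E]]] [h [s [Ph _ _ E']]].
  exact: J_eq (DM (PD Pg) (PD Ph)) (Lmul _ _ _ _ _ _ (PD Pg) E E') Jz.
- move=> n z z' w; rewrite !IJ => Jz [g [t [Pg _ _ E]]].
  by apply: J_eq (PD Pg) _ Jz; rewrite -mulAC// E mulAC//; exact: PD Pg.
- move=> n z z' w; rewrite !IJ => Jz [g [t [Pg _ _ E]]].
  by apply: J_eq (PD Pg) _ Jz; rewrite -!(omulA opA) E.
- move=> n; have [a [t [Pa t0 tn]]] := Psmall' n.
  by exists a, a, t; split=> //=; rewrite -eZ (De (PD Pa)).
Qed.

End Bounded.

Lemma central_bounded (X : Type) (op : X -> X -> X) (e : X) :
  assoc_op op -> ideal_C_closed TzS op -> central op e -> op e e = e ->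
  exists n, forall g, torsion_at op e g -> pow_at op e n.+1 g = e.
Proof.
move=> opA Xcl eZ eI; apply: contrapT => nb.
have [|P [cP Psmall]] := @small_character X op opA e eZ eI; last first.
  exact: small_character_contra opA Xcl _ eZ eI _ cP Psmall.
move=> n; apply: contrapT => /forallNP ng; apply: nb; exists n => g Gg.
by apply: contrapT => gn; apply: (ng g).
Qed.

(** * Ultrafilters of central elements *)

(* Convergence of an ultrafilter of central elements on a set [C] that is
   either linearly ordered ([ch = true]) or has its products in [I]. *)
Section CentralUltrafilter.
Context (X : Type) (op : X -> X -> X) (opA : assoc_op op).
Context (Xcl : ideal_C_closed TzS op) (I : set X) (HI : is_ideal op I).
Context (F : set_system X) {FU : UltraFilter F} (C : set X) (ch : bool).
Hypotheses (FC : F C) (CZ : forall a, C a -> central op a).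
Hypothesis CC : forall a b, C a -> C b ->
  if ch then op a b = a \/ op a b = b else I (op a b).
Local Notation "z * w" := (omul op z w).
Local Notation oI := (oset I).

Let sat (S : set (option X)) := forall w w', orees I w w' -> S w -> S w'.

Let orees_sym w w' : orees I w w' -> orees I w' w.
Proof. by case=> [->|[? ?]]; [left|right]. Qed.

Let orees_trans w w' w'' : orees I w w' -> orees I w' w'' -> orees I w w''.
Proof. by case=> [->|[h1 h2]] // [<-|[h3 h4]]; right. Qed.

Let sat_orees o : sat (orees I o).
Proof. by move=> w w' ww' ow; exact: orees_trans ow ww'. Qed.

Let oreesM u u' v v' : orees I u u' -> orees I v v' ->
  orees I (u * v) (u' * v').
Proof.
have oHI := oset_ideal HI; move=> [<-|[Iu Iu']].
  by move=> [<-|[Iv Iv']]; [left|right; split; exact: (oHI _ _ _).1].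
by move=> _; right; split; exact: (oHI _ _ _).2.
Qed.

Let W (A : set X) (o : option X) : set (option X) := fun w =>
  exists a, [/\ A a, C a & orees I (o * Some a) w].

Let sat_W A o : sat (W A o).
Proof.
by move=> w w' ww' [a [Aa Ca ow]]; exists a; split=> //; exact: orees_trans ow ww'.
Qed.

Let sat_oI : sat oI.
Proof. by move=> w w' [->|[]]. Qed.

(** On a chain the limit is idempotent, so all positive powers share their neighbourhoods; in the
    null case its square is already the zero of the Rees quotient. *)
Let nb (A : {A | F A}) (p : option X * nat) : set (option X) :=
  if p.2 is k.+1 then if (k == 0)%N || ch then W (proj1_sig A) p.1 else oI
  else orees I p.1.

Let sat_nb A p : sat (nb A p).
Proof.
case: p => o [|k]; rewrite /nb /=; first exact: sat_orees.
by case: ifP => _; [exact: sat_W|exact: sat_oI].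
Qed.

(** The ultrafilter contains the set of [a] with [o * a] in [S] or its complement; saturation
    settles the remaining points. *)
Let sat_dec S q : sat S -> exists B, nb B q `<=` S \/ nb B q `<=` ~` S.
Proof.
move=> sS; case: q => o [|k].
  exists (exist _ C FC); have [So|nSo] := pselect (S o); [left|right] => w ow.
    exact: sS ow So.
  by move=> Sw; apply: nSo; exact: sS (orees_sym ow) Sw.
rewrite /nb /=; case: (_ || ch); last first.
  exists (exist _ C FC); have [[w [Sw Iw]]|no] := pselect (exists w, S w /\ oI w).
    by left=> w' Iw'; apply: sS Sw; right.
  by right=> w Iw Sw; apply: no; exists w.
have [FB|FB] := in_ultra_setVsetC [set a | S (o * Some a)] FU.
  by exists (exist _ _ FB); left=> w [a [Sa _ oaw]]; exact: sS oaw Sa.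
exists (exist _ _ FB); right=> w [a [nSa _ oaw]] Sw; apply: nSa.
exact: sS (orees_sym oaw) Sw.
Qed.

Let oZ o a : C a -> o * Some a = Some a * o.
Proof. by case: o => //= x Ca; rewrite (CZ Ca). Qed.

Let mulACC x y a b : C a -> x * Some a * (y * Some b) = x * y * Some (op a b).
Proof.
move=> Ca; rewrite -[Some (op a b)]/(Some a * Some b) !(omulA opA).
by rewrite -(omulA opA x (Some a)) -(oZ y Ca) (omulA opA).
Qed.

Let nb_mul A p q u v : nb A p u -> nb A q v -> nb A (pmul op p q) (u * v).
Proof.
have oHI := oset_ideal HI; have FA := proj2_sig A.
case: p q => [y0 k] [y1 k1]; rewrite /nb /pmul /=.
case: k => [|k]; case: k1 => [|k1]; rewrite ?add0n ?addn0.
- exact: oreesM.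
- case: ifP => _ ou; last by move=> Iv; exact: (oHI _ _ _).1.
  move=> [a [Aa Ca ov]]; exists a; split=> //.
  by rewrite -(omulA opA); exact: oreesM.
- case: ifP => _; last by move=> Iu ov; exact: (oHI _ _ _).2.
  move=> [a [Aa Ca ou]] ov; exists a; split=> //.
  by rewrite -(omulA opA) oZ// (omulA opA); exact: oreesM.
rewrite addnS addSn /=; case ec: ch CC => CC'.
  rewrite !orbT => -[a [Aa Ca ou]] [b [Ab Cb ov]].
  have E : orees I (y0 * y1 * Some (op a b)) (u * v).
    by rewrite -mulACC//; exact: oreesM.
  by have [ab|ab] := CC' a b Ca Cb; [exists a|exists b]; rewrite ab in E.
rewrite !orbF => hu hv.
case: ifP hu => _; last by move=> Iu; exact: (oHI _ _ _).2.
move=> [a [Aa Ca ou]].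
case: ifP hv => _; last by move=> Iv; exact: (oHI _ _ _).1.
move=> [b [Ab Cb ov]].
have := oreesM ou ov; rewrite mulACC// => /sat_oI; apply.
by apply: (oHI _ _ _).1; exists (op a b) => //; exact: CC'.
Qed.

Lemma central_ultrafilter : exists x, F [set a | rees I a x].
Proof.
have := @adjoin_limit X op opA Xcl I HI {A | F A} nb.
have FX A : F A -> exists a, A a /\ C a.
  by move=> FA; have [a [Aa Ca]] := filter_ex (filterI FA FC); exists a.
case=> //.
- by exists; exists C.
- move=> [A FA] [y k]; have [a [Aa Ca]] := FX A FA.
  case: k => [|k]; first by exists y; left.
  rewrite /nb /=; case: ifP => [_|]; first by exists (y * Some a), a; split=> //; left.
  have := CC Ca Ca; case: ch; rewrite ?orbT// => Iaa _.
  by exists (Some (op a a)), (op a a).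
- move=> [A FA] [B FB]; exists (exist _ (A `&` B) (filterI FA FB)) => -[y k].
  case: k => [|k]; first by split.
  rewrite /nb /=; case: (_ || ch); last by split.
  by split=> w [a [[Aa Ba] Ca ow]]; exists a.
- by move=> A p q; apply: sat_dec; exact: sat_nb.
- by move=> A p q; exists A => u v; exact: nb_mul.
- by move=> [A FA]; have [a [Aa Ca]] := FX A FA; exists a, a; split=> //; left.
move=> x [[A FA] hA]; exists x; apply: filterS (filterI FA FC) => a [Aa Ca].
have /hA : nb (exist _ A FA) (None, 1%N) (Some a) by exists a; split=> //; left.
case=> [[->]|[[y Iy [<-]] [b Ib [<-]]]]; first by left.
by right.
Qed.

End CentralUltrafilter.

(** * Free ultrafilters and homogeneous sequences *)

Definition free_ultrafilter (T : Type) (F : set_system T) : Prop :=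
  UltraFilter F /\ forall x, ~ F [set x].

Lemma free_ultrafilter_ex (T : Type) (A : set T) : infinite_set A ->
  exists F : set_system T, free_ultrafilter F /\ F A.
Proof.
move=> Ainf; pose F0 : set_system T := [set B | finite_set (A `\` B)].
have F0P : ProperFilter F0.
  apply: Build_ProperFilter_ex.
    move=> B fB; apply: contrapT => /forallNP nB; apply: Ainf.
    by apply: sub_finite_set fB => x Ax; split.
  split.
  - by rewrite /F0 /= setDT.
  - by move=> P Q fP fQ; rewrite /F0 /= setDIr finite_setU.
  - by move=> P Q PQ; apply: sub_finite_set; exact: setDS.
have [F [FU F0F]] := ultraFilterLemma F0P.
exists F; split; last by apply: F0F; rewrite /F0 /= setDv.
split=> // x Fx; have : F (~` [set x]).
  by apply: F0F; rewrite /F0 /= setDE setCK; exact: finite_setIr.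
by move=> /(filterI Fx); rewrite setICr; exact: filter_not_empty.
Qed.

(* Homogeneous sequences, as in Ramsey's theorem, are read off a free
   ultrafilter by choosing the terms one at a time. *)
Lemma free_ultrafilter_seq (T : Type) (F : set_system T) (A : set T)
    (Rel : T -> T -> Prop) :
  free_ultrafilter F -> F A -> (forall a, A a -> F [set b | Rel a b]) ->
  exists s : nat -> T, [/\ injective s, (forall n, A (s n)) &
    forall m n, (m < n)%N -> Rel (s m) (s n)].
Proof.
move=> [FU Ffree] FA FR.
have FR' a : A a -> F [set b | [/\ A b, Rel a b & b <> a]].
  move=> Aa; have Fa : F (~` [set a]).
    by have [/(Ffree a)|] := in_ultra_setVsetC [set a] FU.
  by apply: filterS (filterI (filterI FA (FR _ Aa)) Fa) => b [[]].
pose ok (l : seq T) := forall x, List.In x l -> A x.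
have next l : ok l -> exists b, A b /\ forall x, List.In x l -> Rel x b /\ b <> x.
  move=> okl; suff /filter_ex[b [Ab hb]] :
    F [set b | A b /\ forall x, List.In x l -> Rel x b /\ b <> x] by exists b.
  elim: l okl => [|x l IH] okl; first by apply: filterS FA => b Ab.
  have /IH h : ok l by move=> y yl; apply: okl; right.
  have Ax : A x by apply: okl; left.
  apply: filterS (filterI h (FR' x Ax)) => b [[Ab hb] [_ Rxb bx]].
  by split=> // y [<-|yl] //; exact: hb.
pose St := {l : seq T | ok l}.
pose nx (l : St) : T := projT1 (cid (next _ (proj2_sig l))).
have nxA l : A (nx l) by rewrite /nx; case: cid => /= b [].
have okS (l : St) : ok (nx l :: proj1_sig l).
  by move=> x [<-|/(proj2_sig l)].
have ok0 : ok [::] by [].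
pose fix st n : St := if n is n'.+1 then exist _ _ (okS (st n')) else exist _ _ ok0.
pose s n := nx (st n).
have sin m n : (m < n)%N -> List.In (s m) (proj1_sig (st n)).
  elim: n => // n IH; rewrite ltnS leq_eqVlt => /orP[/eqP ->|/IH]; first by left.
  by right.
have sR m n : (m < n)%N -> Rel (s m) (s n) /\ s n <> s m.
  move=> /sin; rewrite /(s n) /nx; case: cid => /= b [_ hb] mn.
  exact: hb mn.
exists s; split.
- move=> m n mn; apply/eqP; rewrite eqn_leq; apply/andP.
  split; rewrite leqNgt; apply/negP => /sR[_]; by rewrite mn.
- by move=> n; exact: nxA.
- by move=> m n /sR[].
Qed.

(** * Idempotents and nonregular elements of the center *)

Section Powers.
Context (X : Type) (op : X -> X -> X) (opA : assoc_op op).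

(* [pw n x] is [x ^ (n + 1)]: a semigroup has no zeroth power. *)
Definition pw (n : nat) (x : X) : X := iter n (op x) x.

Lemma pwS n x : pw n.+1 x = op x (pw n x). Proof. by []. Qed.

Lemma pwD m n x : op (pw m x) (pw n x) = pw (m + n).+1 x.
Proof. by elim: m => [//|m IH]; rewrite pwS -opA IH. Qed.

Lemma pwM m n x : pw n (pw m x) = pw (m.+1 * n.+1).-1 x.
Proof.
elim: n => [|n IH]; first by rewrite muln1.
by rewrite pwS IH pwD; congr (pw _ x); rewrite !mulnS/=; lia.
Qed.

Lemma pw_idem n f : op f f = f -> pw n f = f.
Proof. by move=> ff; elim: n => [//|n IH]; rewrite pwS IH. Qed.

Lemma pw_central n x : central op x -> central op (pw n x).
Proof.
by move=> xZ; elim: n => [//|n IH] y; rewrite pwS -opA IH opA xZ -opA.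
Qed.

Lemma pw_mul n x y : central op x -> pw n (op x y) = op (pw n x) (pw n y).
Proof.
move=> xZ; elim: n => [//|n IH]; rewrite !pwS IH -!opA; congr (op x _).
by rewrite !opA -(pw_central n xZ).
Qed.

Lemma central_op x y : central op x -> central op y -> central op (op x y).
Proof. by move=> xZ yZ z; rewrite -opA yZ opA xZ -opA. Qed.

Lemma periodic_idempotent n k x : pw n x = pw (n + k.+1) x ->
  exists m, op (pw m x) (pw m x) = pw m x.
Proof.
move=> E.
have per1 m : (n <= m)%N -> pw (m + k.+1) x = pw m x.
  move=> /subnK <-; case: (m - n)%N => [|d]; first by rewrite add0n.
  by rewrite addSn -pwD E pwD !addSn -addnA.
have per m j : (n <= m)%N -> pw (m + j * k.+1) x = pw m x.
  move=> nm; elim: j => [|j IH]; first by rewrite addn0.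
  rewrite mulSn (addnC k.+1) addnA per1 ?IH//.
  by rewrite (leq_trans nm)// leq_addr.
exists (n.+1 * k.+1).-1.
rewrite pwD.
have -> : (((n.+1 * k.+1).-1 + (n.+1 * k.+1).-1).+1 =
    (n.+1 * k.+1).-1 + n.+1 * k.+1)%N by lia.
by apply: per; lia.
Qed.

(** Used below mostly as a relation: divisibility in [X] with an identity adjoined. *)
Definition principal_ideal (z : X) : set X :=
  [set w | w = z \/ exists s, w = op z s].

Lemma principal_idealM z w s :
  principal_ideal z w -> principal_ideal z (op w s).
Proof. by move=> [->|[t ->]]; right; [exists s|exists (op t s)]. Qed.

Lemma principal_ideal_ideal z : central op z -> is_ideal op (principal_ideal z).
Proof.
move=> zZ s w zw; split; last exact: principal_idealM.
case: zw => [->|[t ->]]; first by right; exists s; rewrite zZ.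
by right; exists (op s t); rewrite opA -zZ -opA.
Qed.

Lemma principal_ideal_trans x y z :
  principal_ideal x y -> principal_ideal y z -> principal_ideal x z.
Proof. by move=> xy [->|[s ->]] //; exact: principal_idealM. Qed.

Lemma principal_ideal_sub I z w :
  is_ideal op I -> I z -> principal_ideal z w -> I w.
Proof. by move=> HI Iz [->|[s ->]] //; exact: (HI _ _ Iz).2. Qed.

Lemma principal_ideal_mul z w t : central op t ->
  principal_ideal z w -> principal_ideal (op z t) (op w t).
Proof.
by move=> tZ [->|[s ->]]; [left|right; exists s; rewrite -!opA tZ].
Qed.

Lemma bigcup_ideal (J : Type) (P : set J) (I : J -> set X) :
  (forall j, P j -> is_ideal op (I j)) -> is_ideal op (\bigcup_(j in P) I j).
Proof.
by move=> HI s w [j Pj Iw]; have [h1 h2] := HI j Pj s w Iw; split; exists j.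
Qed.

Lemma setU_ideal (I J : set X) :
  is_ideal op I -> is_ideal op J -> is_ideal op (I `|` J).
Proof.
move=> HI HJ s w [/(HI s)|/(HJ s)] [h1 h2].
  by split; left.
by split; right.
Qed.

(* Iterating [w = w * z * s] gives [w = z ^ n * t] for every [n]. *)
Lemma absorbing_pw z w : central op z -> principal_ideal (op w z) w ->
  forall n, exists t, w = op (pw n z) t.
Proof.
move=> zZ wz.
have [s ws] : exists s, w = op z (op w s).
  case: wz => [E|[s E]]; last by exists s; rewrite opA zZ.
  by exists z; rewrite -E zZ.
elim=> [|n [t IH]]; first by exists (op w s).
by exists (op t s); rewrite ws {1}IH pwS -!opA.
Qed.

Lemma nil_absorbing I z w n : is_ideal op I -> central op z -> I (pw n z) ->
  principal_ideal (op w z) w -> I w.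
Proof.
move=> HI zZ Iz /(absorbing_pw zZ)/(_ n)[t ->]; exact: (HI _ _ Iz).2.
Qed.

End Powers.

Lemma injective_range_infinite (T : Type) (s : nat -> T) :
  injective s -> infinite_set (range s).
Proof.
by move=> sI; rewrite (eq_finite_set (inj_card_eq (in2W sI))); exact: infinite_nat.
Qed.

Section IdeallyClosed.
Context (X : Type) (op : X -> X -> X) (opA : assoc_op op).
Context (Xcl : ideal_C_closed TzS op).
Local Notation pw := (pw op).
Local Notation idl := (principal_ideal op).

Let set0_ideal : is_ideal op set0. Proof. by []. Qed.

(** For the empty ideal Rees classes are points, and a free ultrafilter cannot converge to a
    point. *)
Lemma central_chain (C : set X) : (forall a, C a -> central op a) ->
  (forall a b, C a -> C b -> op a b = a \/ op a b = b) -> finite_set C.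
Proof.
move=> CZ CC; apply: contrapT => /free_ultrafilter_ex[F [[FU Ffree] FC]].
have [x] := @central_ultrafilter X op opA Xcl _ set0_ideal F FU C true FC CZ CC.
by apply: contra_not (Ffree x) => /filterS; apply=> a [->|[]].
Qed.

(** A free ultrafilter on [A] could converge only to the class [I], which [A] avoids. *)
Lemma central_null (I A : set X) : is_ideal op I ->
  (forall a, A a -> central op a) -> (forall a, A a -> ~ I a) ->
  (forall a b, A a -> A b -> I (op a b)) -> finite_set A.
Proof.
move=> HI AZ AI AA; apply: contrapT => /free_ultrafilter_ex[F [[FU Ffree] FA]].
have [x Fx] := @central_ultrafilter X op opA Xcl _ HI F FU A false FA AZ AA.
apply: (Ffree x); apply: filterS (filterI Fx FA) => a [[->//|[Ia _]] Aa].
by case: (AI a Aa).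
Qed.

(** Elements with square in [I] form a null set [A1]. Adding to [I] the multiples of the squares of
    the others makes these null too: if [a * a] divides another such [c], then [a * a * c] divides
    [c * c], which puts [c] into [A1]. *)
Lemma central_almost_null (I A : set X) : is_ideal op I ->
  (forall a, A a -> central op a) -> (forall a, A a -> ~ I a) ->
  (forall a b, A a -> A b -> a <> b -> I (op a b)) ->
  (forall a, A a -> ~ idl (op a a) a) -> finite_set A.
Proof.
move=> HI AZ AI AA Aa2; apply: contrapT => Ainf.
pose A1 := [set a | A a /\ I (op a a)].
have A1fin : finite_set A1.
  apply: (central_null HI) => [a [Aa _]|a [Aa _]|a b [Aa Iaa] [Ab _]].
  - exact: AZ.
  - exact: AI.
  - by have [<-//|ab] := pselect (a = b); exact: AA.
apply: (infinite_setD Ainf A1fin).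
apply: (@central_null (I `|` \bigcup_(a in A `\` A1) idl (op a a))).
- apply: setU_ideal => //; apply: bigcup_ideal => a [Aa _].
  exact: (principal_ideal_ideal opA (central_op opA (AZ a Aa) (AZ a Aa))).
- by move=> a [/AZ].
- move=> c [Ac A1c] [/(AI c Ac)//|[a [Aa _] ac]].
  have [ca|ca] := pselect (c = a); first by rewrite -ca in ac; exact: (Aa2 c Ac).
  apply: A1c; split=> //.
  have : idl (op (op a a) c) (op c c) by apply: (principal_ideal_mul opA (AZ c Ac) ac).
  apply: principal_ideal_sub => //; rewrite -opA; apply: (HI _ _ _).1.
  by apply: AA => // /esym.
- move=> a b [Aa A1a] [Ab _].
  have [<-|ab] := pselect (a = b); last by left; exact: AA.
  by right; exists a => //; left.
Qed.

(** Stated for an abstract strict order so as to yield both chain conditions. A failure gives an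
    infinite chain by dependent choice. *)
Lemma central_idempotent_extremal (R : X -> X -> Prop) (A : set X) :
  (forall a b c, R a b -> R b c -> R a c) -> (forall a, ~ R a a) ->
  (forall a b, R a b ->
     (op a b = a \/ op a b = b) /\ (op b a = a \/ op b a = b)) ->
  (forall a, A a -> central op a /\ op a a = a) -> A !=set0 ->
  exists m, A m /\ forall a, A a -> ~ R a m.
Proof.
move=> Rt Ri RC AZ [a0 Aa0]; apply: contrapT => nm.
have next (a : {a | A a}) : exists b : {b | A b}, R (proj1_sig b) (proj1_sig a).
  apply: contrapT => nb; apply: nm; exists (proj1_sig a).
  split; first exact: proj2_sig.
  by move=> b Ab Rb; apply: nb; exists (exist _ b Ab).
pose fix st n : {a | A a} :=
  if n is n'.+1 then projT1 (cid (next (st n'))) else exist _ a0 Aa0.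
pose s n := proj1_sig (st n).
have sS n : R (s n.+1) (s n) := projT2 (cid (next (st n))).
have sR m n : (m < n)%N -> R (s n) (s m).
  elim: n => // n IH; rewrite ltnS leq_eqVlt => /orP[/eqP ->|/IH]; first exact: sS.
  exact: Rt.
have sI : injective s.
  move=> m n mn; apply/eqP; rewrite eqn_leq; apply/andP.
  by split; rewrite leqNgt; apply/negP => /sR; rewrite mn; exact: Ri.
have : finite_set (range s).
  apply: central_chain.
    by move=> _ [n _ <-]; have [] := AZ _ (proj2_sig (st n)).
  move=> _ _ [m _ <-] [n _ <-]; case: (ltngtP m n) => [/sR/RC[]|/sR/RC[]|<-].
  - by move=> _ [h|h]; [right|left].
  - by move=> [h|h]; [left|right].
  - by left; have [_ ->] := AZ _ (proj2_sig (st m)).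
exact: injective_range_infinite.
Qed.

End IdeallyClosed.

Lemma ultra_const (T U : Type) (F : set_system T) (A : set T) (f : T -> U) :
  free_ultrafilter F -> F A -> (forall u, ~ F [set t | f t = u]) ->
  exists s : nat -> T, injective (f \o s) /\ forall n, A (s n).
Proof.
move=> Ffree FA nc; have FU := Ffree.1.
have [|s [_ sA sR]] := @free_ultrafilter_seq _ F A (fun a b => f b <> f a) Ffree FA.
  move=> a _; have [/nc|] // := in_ultra_setVsetC [set t | f t = f a] FU.
exists s; split=> // m n /= mn; apply/eqP; rewrite eqn_leq; apply/andP.
by split; rewrite leqNgt; apply/negP => /sR; rewrite mn.
Qed.

(** * Central elements nilpotent modulo an ideal *)

Section NilElements.
Context (X : Type) (op : X -> X -> X) (opA : assoc_op op).
Context (Xcl : ideal_C_closed TzS op) (I : set X) (HI : is_ideal op I).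
Local Notation pw := (pw op).
Local Notation idl := (principal_ideal op).
Local Notation "a ~ b" := (rees I a b) (at level 70).

Let T : set X := [set z | [/\ central op z, ~ I z & exists n, I (pw n z)]].
Context (F : set_system X).
Hypotheses (Ffree : free_ultrafilter F) (FT : F T).

Let FU : UltraFilter F := Ffree.1.

#[local] Existing Instance FU.

Let rees_sym a b : a ~ b -> b ~ a.
Proof. by case=> [->|[]]; [left|right]. Qed.

Let rees_trans a b c : a ~ b -> b ~ c -> a ~ c.
Proof. by case=> [->|[h1 h2]] // [<-|[h3 h4]]; right. Qed.

Let rees_opr a b c : a ~ b -> op a c ~ op b c.
Proof. by case=> [->|[Ia Ib]]; [left|right; split; [exact: (HI c Ia).2|exact: (HI c Ib).2]]. Qed.

Let rees_I a b : a ~ b -> I a -> I b.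
Proof. by case=> [->|[]]. Qed.

Let idlI z w : I z -> idl z w -> I w.
Proof. exact: principal_ideal_sub. Qed.

Let converges z := exists c, F [set t | op z t ~ c].

(** For most [t] the element [z * t] lies in [I] or is a multiple of [c]: otherwise infinitely many
    [z * t] would form a null set modulo [I] and [c]. *)
Let converges_sqrt z : central op z -> (exists n, I (pw n z)) ->
  converges (op z z) -> converges z.
Proof.
move=> zZ [n zn] [c0 Fc0]; apply: contrapT => nz.
have [t0 [[t0Z _ _] t0c]] := filter_ex (filterI FT Fc0).
pose c := op (op z z) t0.
have cZ : central op c by exact: (central_op opA (central_op opA zZ zZ) t0Z).
pose A := [set t | op (op z z) t ~ c].
have FA : F A.
  by apply: filterS Fc0 => t tc; apply: rees_trans tc _; exact: rees_sym.
pose I' := I `|` idl c.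
have HI' : is_ideal op I' by apply: setU_ideal => //; exact: principal_ideal_ideal.
have FI' : F [set t | I' (op z t)].
  have [//|FnI'] := in_ultra_setVsetC [set t | I' (op z t)] FU.
  have FB : F (T `&` A `&` ~` [set t | I' (op z t)]).
    exact: filterI (filterI FT FA) FnI'.
  have [u Fu|s [sI sB]] := @ultra_const _ _ _ _ (op z) Ffree FB.
    by apply: nz; exists u; apply: filterS Fu => t zt; left.
  case: (injective_range_infinite sI); apply: (central_null opA Xcl HI').
  - by move=> _ [k _ <-]; have [[[sZ _ _] _] _] := sB k; exact: central_op.
  - by move=> _ [k _ <-]; have [_ /=] := sB k.
  - move=> _ _ [k _ <-] [l _ <-] /=.
    have [[[sZ _ _] Ak] _] := sB k; have [[[lZ _ _] _] _] := sB l.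
    have -> : op (op z (s k)) (op z (s l)) = op (op (op z z) (s k)) (s l).
      by rewrite !opA; congr (op _ _); rewrite -!opA sZ.
    apply: (HI' _ _ _).2; case: Ak => [->|[Ik _]]; last by left.
    by right; left.
have [FI|FnI] := in_ultra_setVsetC [set t | I (op z t)] FU.
  have [t It] := filter_ex FI.
  by apply: nz; exists (op z t); apply: filterS FI => u Iu; right.
have [t [[[At I't] nIt] [tZ _ _]]] :=
  filter_ex (filterI (filterI (filterI FA FI') FnI) FT).
apply: nIt; case: I't => // ct.
(* Now [c = z * z * t] divides [z * t], so [z * t] absorbs a factor [z], and the nilpotence of [z]
   puts it into [I]. *)
have [zzt|[_ Ic]] := At; last exact: idlI Ic ct.
apply: (nil_absorbing opA HI zZ zn); rewrite -zzt in ct.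
by rewrite -zZ opA.
Qed.

Let pw_square n z : central op z -> idl (pw n.+1 z) (pw n (op z z)).
Proof.
move=> zZ; rewrite (pw_mul opA)// (pwD opA); case: n => [|n]; first by left.
by right; exists (pw n z); rewrite (pwD opA); congr (pw _ z); lia.
Qed.

(** Induction on the exponent of nilpotence, which drops on passing to [z * z]. *)
Let nil_converges z : central op z -> (exists n, I (pw n z)) -> converges z.
Proof.
move=> zZ [n]; elim: n z zZ => [|n IH] z zZ Iz.
  exists z; apply: filterS FT => t _; right; split=> //; exact: (HI _ Iz).2.
apply: converges_sqrt => //; first by exists n.+1.
apply: IH; first exact: central_op.
exact: idlI Iz (pw_square n zZ).
Qed.

(** The limit is realized as a product [w * t], hence is central and divisible by [w]. The condition
    [T w] stands under the quantifier so that [lim] is total. *)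
Let limitP w : exists c, T w ->
  [/\ central op c, idl w c & F [set t | op w t ~ c]].
Proof.
have [[wZ wI wn]|nT] := pselect (T w); last by exists w.
have [c Fc] := nil_converges wZ wn.
have [t [[tZ _ _] tc]] := filter_ex (filterI FT Fc).
exists (op w t) => _; split; first exact: central_op.
  by right; exists t.
by apply: filterS Fc => u uc; apply: rees_trans uc _; exact: rees_sym.
Qed.

Let lim w := projT1 (cid (limitP w)).

Let limZ w : T w -> central op (lim w).
Proof. by move=> Tw; rewrite /lim; case: cid => /= c /(_ Tw)[]. Qed.

Let lim_idl w : T w -> idl w (lim w).
Proof. by move=> Tw; rewrite /lim; case: cid => /= c /(_ Tw)[]. Qed.

Let limF w : T w -> F [set t | op w t ~ lim w].
Proof. by move=> Tw; rewrite /lim; case: cid => /= c /(_ Tw)[]. Qed.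

Let Z : set X := [set z | T z /\ F [set w | idl (lim w) z]].

Let Z_small : ~ F Z.
Proof.
move=> FZ; have [z [Tz Fz]] := filter_ex FZ.
have [w [wz Tw]] := filter_ex (filterI Fz FT); have [wZ _ _] := Tw.
have FA := limF Tw.
have [u [uA [[uZ _ [n Iu]] _]]] := filter_ex (filterI FA FZ).
(* As [w * t = lim w] for all [t] near the limit, [w * p = w * u ^ k] for any
   product [p] of [k] such elements, while every [v] in [Z] is divisible by
   such products for all [k]. *)
have div k v : Z v -> exists p, op w p ~ op w (pw k u) /\ idl p v.
  elim: k v => [|k IH] v [Tv Fv].
    have [x [[vx xA] Tx]] := filter_ex (filterI (filterI Fv FA) FT).
    exists x; split; first by apply: rees_trans xA _; exact: rees_sym.
    exact: principal_ideal_trans (lim_idl Tx) vx.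
  have [x [[vx xA] Zx]] := filter_ex (filterI (filterI Fv FA) FZ).
  have Tx := Zx.1; have [p [wp px]] := IH x Zx.
  have [t [[tx tA] [tZ _ _]]] := filter_ex (filterI (filterI (limF Tx) FA) FT).
  exists (op p t); split.
    rewrite opA; apply: rees_trans (rees_opr _ wp) _.
    rewrite -opA (pw_central opA k uZ) opA.
    rewrite pwS opA; apply: rees_opr; apply: rees_trans tA _; exact: rees_sym.
  have E : op x t = lim x.
    by case: tx => // -[_ Ix]; case: Tv => _ []; exact: idlI Ix vx.
  rewrite /= -E in vx.
  exact: principal_ideal_trans (principal_ideal_mul opA tZ px) vx.
have [v [vA Zv]] := filter_ex (filterI FA FZ).
have [[vZ _ _] _] := Zv; have [p [wp pv]] := div n v Zv.
(* As [u] is nilpotent, [w * p] and its multiple [w * v] lie in [I]; so do [lim w] and its multiple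
   [z], against [T z]. *)
have Iwp : I (op w p) by apply: rees_I (rees_sym wp) _; exact: (HI w Iu).1.
have Iwv : I (op w v).
  case: pv => [->//|[s ->]]; rewrite opA; exact: (HI s Iwp).2.
by case: Tz => _ []; apply: idlI wz; exact: rees_I vA Iwv.
Qed.

(** Along a homogeneous sequence [s m * s n] is [lim (s m)] modulo [I] for [m < n], and [lim (s n)]
    does not divide [s m]. Modulo the ideal of these limits the sequence is almost null, yet no term
    falls into that ideal. *)
Lemma nil_ultrafilter : False.
Proof.
have FnZ : F (~` Z) by have [/Z_small|] := in_ultra_setVsetC Z FU.
pose Rel z w := op z w ~ lim z /\ ~ idl (lim w) z.
have [|s [sI sA sR]] := @free_ultrafilter_seq _ F (T `&` ~` Z) Rel Ffree (filterI FT FnZ).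
  move=> z [Tz nZz]; apply: (@filterI _ F); first exact: limF.
  by have [Fz|//] := in_ultra_setVsetC [set w | idl (lim w) z] FU; case: nZz.
have Ts n : T (s n) := (sA n).1.
have nil_abs z w : T z -> T w -> ~ idl (op w z) w.
  move=> [zZ _ [n zn]] [_ nIw _] wz; apply: nIw.
  exact: (nil_absorbing opA HI zZ zn).
pose I' := I `|` \bigcup_n idl (lim (s n)).
apply: (injective_range_infinite sI).
apply: (@central_almost_null X op opA Xcl I').
- apply: setU_ideal => //; apply: bigcup_ideal => n _.
  by apply: principal_ideal_ideal => //; exact: limZ.
- by move=> _ [n _ <-]; case: (Ts n).
- move=> _ [i _ <-] [|[j _ ij]]; first by case: (Ts i).
  have [ltij|leji] := ltnP i j; first by case: (sR _ _ ltij).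
  (* With this [k] beyond [j], [lim (s j)] is [s j * s k]; if it divided [s i], then [s i] would
     absorb a nilpotent factor. *)
  pose k := if (j < i)%N then i else i.+1.
  have jk : (j < k)%N.
    by rewrite /k; case: ifPn => //; rewrite ltnS -ltnNge ltnS.
  have ijk : idl (op (s j) (s k)) (s i).
    have [[->//|[_ Il]] _] := sR _ _ jk.
    by have [_ nIi _] := Ts i; case: nIi; exact: idlI Il ij.
  have [siZ _ _] := Ts i; have [sjZ _ _] := Ts j; move: ijk; rewrite /k.
  case: ifPn => [_|]; first by rewrite sjZ; exact: nil_abs.
  rewrite -leqNgt => lij; have -> : j = i by lia.
  exact: nil_abs.
- move=> _ _ [i _ <-] [j _ <-] ij.
  have Ilim m n : (m < n)%N -> I' (op (s m) (s n)).
    move=> /sR[[->|[Imn _]] _]; last by left.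
    by right; exists m => //; left.
  case: (ltngtP i j) => [/Ilim //|/Ilim|eij]; last by rewrite eij in ij.
  by have [sjZ _ _] := Ts j; rewrite sjZ.
- by move=> _ [n _ <-]; exact: nil_abs.
Qed.

End NilElements.

(** * Finiteness of the nonregular part of the center *)

Section Nonregular.
Context (X : Type) (op : X -> X -> X) (opA : assoc_op op).
Context (Xcl : ideal_C_closed TzS op).
Local Notation pw := (pw op).
Local Notation idl := (principal_ideal op).

Lemma central_nil_finite (I : set X) : is_ideal op I ->
  finite_set [set z | [/\ central op z, ~ I z & exists n, I (pw n z)]].
Proof.
move=> HI; apply: contrapT => /free_ultrafilter_ex[F [Ffree FT]].
exact: (nil_ultrafilter opA Xcl HI Ffree FT).
Qed.

Lemma central_idempotent_power x : central op x ->
  exists n, op (pw n x) (pw n x) = pw n x.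
Proof.
move=> xZ; have [n [k E]] := central_periodic opA Xcl xZ.
exact: (periodic_idempotent opA) E.
Qed.

(** Both idempotents are powers with the common exponent [(l + 1) * (k + 1)], and divisibility
    passes to powers. *)
Let divisor_idempotent u w l k : central op u ->
  op (pw l u) (pw l u) = pw l u -> op (pw k w) (pw k w) = pw k w ->
  idl u w -> op (pw l u) (pw k w) = pw k w.
Proof.
move=> uZ ue we uw.
have E : pw k w = pw (l.+1 * k.+1).-1 w by rewrite mulnC -(pwM opA) (pw_idem _ we).
have E' : pw l u = pw (l.+1 * k.+1).-1 u by rewrite -(pwM opA) (pw_idem _ ue).
case: uw => [wu|[s ws]]; first by rewrite E wu -E' ue.
by rewrite E ws (pw_mul opA)// -E' opA ue.
Qed.

(** Since [pw k.+1 x] is [x ^ (k + 2)], these are the central elements lying in no finite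
    subgroup. *)
Let N : set X := [set x | central op x /\ forall k, pw k.+1 x <> x].

Let N_fix x k e : N x -> pw k x = e -> op e x <> x.
Proof.
by move=> [xZ xk] <-; rewrite (pw_central opA k xZ) -pwS; exact: xk.
Qed.

Let ideal_fix e : central op e -> is_ideal op [set y | op e y = y].
Proof. by move=> eZ s y /= ey; split; [rewrite opA eZ -opA ey|rewrite opA ey]. Qed.

(** Modulo the ideal of elements fixed by [e] these [x] are nilpotent, and none of them is fixed. *)
Let idem_class_finite e : central op e -> op e e = e ->
  finite_set [set x | N x /\ exists k, pw k x = e].
Proof.
move=> eZ ee; apply: sub_finite_set (central_nil_finite (ideal_fix eZ)).
move=> x [Nx [k xk]] /=; split.
- by case: Nx.
- exact: N_fix xk.
- by exists k; rewrite xk.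
Qed.

(** Each idempotent is a power of finitely many [x] in [N]. Infinitely many idempotents would
    contain an infinite chain, which is excluded, or an infinite antichain, whose roots [x n] are
    almost null modulo their mutual products. *)
Lemma central_nonregular_finite : finite_set N.
Proof.
have pow x : exists k, N x -> op (pw k x) (pw k x) = pw k x.
  have [[xZ _]|nN] := pselect (N x); last by exists 0%N.
  by have [k xk] := central_idempotent_power xZ; exists k.
pose k x := projT1 (cid (pow x)); pose p x := pw (k x) x.
have p_idem x : N x -> op (p x) (p x) = p x by exact: projT2 (cid (pow x)).
have pZ x : N x -> central op (p x) by move=> [xZ _]; exact: pw_central.
have [pfin|pinf] := pselect (finite_set (p @` N)).
  have : finite_set (\bigcup_(e in p @` N) [set x | N x /\ exists k, pw k x = e]).
    apply: bigcup_finite => // _ [x Nx <-].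
    by apply: idem_class_finite; [exact: pZ|exact: p_idem].
  by apply: sub_finite_set => x Nx; exists (p x); [exists x|split=> //; exists (k x)].
have [F [Ffree FE]] := free_ultrafilter_ex pinf; have [FU _] := Ffree.
pose below a b := op b a = b.
have chain (s : nat -> X) : injective s -> (forall n, (p @` N) (s n)) ->
    (forall m n, (m < n)%N -> op (s m) (s n) = s m \/ op (s m) (s n) = s n) -> False.
  move=> sI sE sC; apply: (injective_range_infinite sI).
  have sZ n : central op (s n) by have [x Nx <-] := sE n; exact: pZ.
  apply: (central_chain opA Xcl) => [_ [n _ <-]//|_ _ [m _ <-] [n _ <-]].
  case: (ltngtP m n) => [/sC //|/sC|<-].
    by rewrite sZ => -[->|->]; [right|left].
  by left; have [x Nx <-] := sE m; exact: p_idem.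
pose comp a b := op a b = a \/ op a b = b.
have [FC|FnC] := in_ultra_setVsetC [set a | F [set b | comp a b]] FU.
  have [|s [sI sE sR]] := @free_ultrafilter_seq _ F _ comp Ffree (filterI FE FC).
    by move=> a [].
  by case: (chain s sI) => // n; have [] := sE n.
have FnC' : F (p @` N `&` [set a | F [set b | ~ comp a b]]).
  apply: (@filterI _ F) => //; apply: filterS FnC => a.
  by have [|] := in_ultra_setVsetC [set b | comp a b] FU.
have [|s [sI sE sR]] :=
  @free_ultrafilter_seq _ F _ (fun a b => ~ comp a b) Ffree FnC'.
  by move=> a [].
have /choice[x xs] : forall n, exists x, N x /\ p x = s n.
  by move=> n; have [[x Nx <-] _] := sE n; exists x.
have xN n := (xs n).1; have xZ n : central op (x n) := (xN n).1.
have sZ n : central op (s n) by rewrite -(xs n).2; exact: pZ.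
have anti m n : op (s m) (s n) = s n -> m = n.
  move=> E; case: (ltngtP m n) => // /sR; case; first by right.
  by left; rewrite sZ.
have xI : injective x by move=> m n mn; apply: sI; rewrite -!(xs _).2 mn.
case: (injective_range_infinite xI).
pose J m n := if m == n then set0 else idl (op (x m) (x n)).
pose I := \bigcup_m \bigcup_n J m n.
(* Divisibility between roots would make their idempotents comparable. *)
have div m n : idl (x m) (x n) -> m = n.
  move=> mn; apply: anti; rewrite -!(xs _).2.
  by apply: divisor_idempotent => //; exact: p_idem.
apply: (@central_almost_null X op opA Xcl I).
- apply: bigcup_ideal => m _; apply: bigcup_ideal => n _.
  rewrite /J; case: eqP => // _; apply: principal_ideal_ideal => //.
  exact: central_op.
- by move=> _ [n _ <-].
- move=> _ [n _ <-] [l _ [m _]]; rewrite /J; case: eqP => // lm lmn; apply: lm.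
  have -> : l = n by apply: div; apply: (principal_ideal_trans opA _ lmn); right; exists (x m).
  apply/esym/div; apply: (principal_ideal_trans opA _ lmn); rewrite xZ.
  by right; exists (x l).
- move=> _ _ [m _ <-] [n _ <-] mn; exists m => //; exists n => //.
  by rewrite /J; case: eqP => [emn|_]; [rewrite emn in mn|left].
- move=> _ [n _ <-] /(absorbing_pw opA (xZ n))/(_ (k (x n)))[t xt].
  apply: (N_fix (xN n) erefl).
  suff H y : y = op (p (x n)) t -> op (p (x n)) y = y by exact: H.
  by move=> ->; rewrite opA p_idem.
Qed.

End Nonregular.

(** * Closed commutative semigroups *)

(** The algebraic properties of the center that pass to quotients and force closedness. Idempotents
    are ordered by [a <= b] when [m a b = a]. *)
Record tame (Q : Type) (m : Q -> Q -> Q) : Prop := Tame {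
  tame_assoc : assoc_op m;
  tame_comm : forall x y, m x y = m y x;
  tame_periodic : forall x, exists k, m (pw m k x) (pw m k x) = pw m k x;
  tame_min : forall A : set Q, (forall a, A a -> m a a = a) -> A !=set0 ->
    exists e, A e /\ forall a, A a -> m a e = a -> a = e;
  tame_max : forall A : set Q, (forall a, A a -> m a a = a) -> A !=set0 ->
    exists e, A e /\ forall a, A a -> m a e = e -> a = e;
  tame_bounded : forall e, m e e = e -> exists n, forall x, m e x = x ->
    (exists k, pw m k x = e) -> pw m n x = e;
  tame_nonregular : finite_set [set x | forall k, pw m k.+1 x <> x]
}.

Section MaximalSubgroups.
Context (Q : Type) (m : Q -> Q -> Q).
Hypotheses (mA : assoc_op m) (mC : forall x y, m x y = m y x).

(* [x] lies in the maximal subgroup of [e], for [x] periodic. *)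
Definition in_group (e x : Q) : Prop :=
  [/\ m e e = e, m e x = x & exists k, pw m k x = e].

Lemma regular_in_group x k : pw m k.+1 x = x -> in_group (pw m k x) x.
Proof.
move=> xk; split; [|by rewrite mC|by exists k].
rewrite (pwD mA); case: k xk => [//|k xk].
by rewrite addSnnS -(pwD mA) xk mC.
Qed.

Lemma in_group_inj e d x : in_group e x -> in_group d x -> e = d.
Proof.
move=> [ee _ [k xk]] [dd _ [l xl]].
by rewrite -(pw_idem l ee) -(pw_idem k dd) -xk -xl !(pwM mA) mulnC.
Qed.

Lemma in_group_mul e d x y :
  in_group e x -> in_group d y -> in_group (m e d) (m x y).
Proof.
have mACA a b c f : m (m a b) (m c f) = m (m a c) (m b f).
  by rewrite !mA; congr (m _ f); rewrite -!mA (mC b).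
move=> [ee ex [k xk]] [dd dy [l yl]]; split.
- by rewrite mACA ee dd.
- by rewrite mACA ex dy.
exists (k.+1 * l.+1).-1; rewrite (pw_mul mA); last exact: mC.
by rewrite -(pwM mA) xk (pw_idem _ ee) mulnC -(pwM mA) yl (pw_idem _ dd).
Qed.

Lemma in_group_self e : m e e = e -> in_group e e.
Proof. by move=> ee; split=> //; exists 0%N. Qed.

End MaximalSubgroups.

Section Closedness.
Context (Q : Type) (m : Q -> Q -> Q) (Qt : tame m).
Context (Y : topologicalType) (mul : Y -> Y -> Y) (YT : T1S mul).
Context (h : Q -> Y) (hemb : iso_top_embedding m mul h).

Let mA := tame_assoc Qt.
Let mC := tame_comm Qt.
Local Notation grp := (in_group m).

Let hI : injective h. Proof. by case: hemb. Qed.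
Let hM a b : h (m a b) = mul (h a) (h b). Proof. by case: hemb. Qed.

Let mulYA : assoc_op mul. Proof. by case: YT => -[]. Qed.

Let mul_nbhs a b B : nbhs (mul a b) B -> exists U V,
  [/\ nbhs a U, nbhs b V & forall u v, U u -> V v -> B (mul u v)].
Proof.
have [[_ mulc] _] := YT; move=> /(mulc (a, b)) [[U V] /= [aU bV] UV].
by exists U, V; split=> // u v Uu Vv; apply: (UV (u, v)); split.
Qed.

Let h_isolated q : exists2 U, nbhs (h q) U & forall x, U (h x) -> x = q.
Proof.
have [_ _ /(_ q)[U [oU Uq]]] := hemb; exists U.
  apply: open_nbhs_nbhs; split=> //.
  by have [] : (U `&` range h) (h q) by rewrite Uq.
move=> x Ux; apply: hI.
have : (U `&` range h) (h x) by split=> //; exists x.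
by rewrite Uq.
Qed.

Let mul_isolated a b q : mul a b = h q -> exists U V,
  [/\ nbhs a U, nbhs b V & forall x y, U (h x) -> V (h y) -> m x y = q].
Proof.
move=> abq; have [W qW Wq] := h_isolated q.
rewrite -abq in qW; have [U [V [aU bV UV]]] := mul_nbhs qW.
by exists U, V; split=> // x y Ux Vy; apply: Wq; rewrite hM; exact: UV.
Qed.

Let closure_const (a y : Y) : closure [set a] y -> y = a.
Proof.
have [_ T1] := YT; have /closure_id E := accessible_closed_set1 T1 (x := a).
by rewrite -E.
Qed.

Let closure_near (A : set Q) (U : set Y) (y : Y) : closure (h @` A) y -> nbhs y U ->
  exists x, A x /\ U (h x).
Proof. by move=> Ay yU; have [_ [[x Ax <-] Ux]] := Ay U yU; exists x. Qed.

Let closure_nearS (A : set Q) (U : set Y) (y : Y) : closure (h @` A) y -> nbhs y U ->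
  closure (h @` (A `&` [set x | U (h x)])) y.
Proof.
move=> Ay yU V yV; have [x [Ax [Ux Vx]]] := closure_near Ay (filterI yU yV).
by exists (h x); split=> //; exists x.
Qed.

Let closure_eq (A : set Q) (y : Y) q : closure (h @` A) y ->
  (forall x, A x -> x = q) -> y = h q.
Proof.
move=> Ay Aq; apply: closure_const; apply: closureS Ay.
by move=> _ [x /Aq -> <-].
Qed.

Let closure_mull (A : set Q) (y : Y) f : closure (h @` A) y ->
  closure (h @` [set m f x | x in A]) (mul (h f) y).
Proof.
move=> Ay W /mul_nbhs[U [V [fU yV UV]]].
have [x [Ax Vx]] := closure_near Ay yV.
exists (h (m f x)); split; first by exists (m f x) => //; exists x.
by rewrite hM; apply: UV => //; exact: nbhs_singleton fU.
Qed.

Let pwY k z := iter k (mul z) z.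

Let h_pw k x : h (pw m k x) = pwY k (h x).
Proof. by elim: k => // k IH; rewrite pwS hM IH. Qed.

Let pwY_nbhs k y B : nbhs (pwY k y) B -> nbhs y [set z | B (pwY k z)].
Proof.
elim: k B => [|k IH] B; first by [].
move=> /mul_nbhs[U [V [yU /IH yV UV]]].
by apply: filterS (filterI yU yV) => z [Uz Vz]; exact: UV.
Qed.

(* In a group of exponent [n], a limit [y] satisfies [y ^ n = e]; as [e] is
   isolated, the elements near [y] are all inverse to one [w ^ (n - 1)]. *)
Let closure_group e (A : set Q) (y : Y) : closure (h @` A) y ->
  (forall x, A x -> grp e x) -> exists q, y = h q.
Proof.
move=> Ay Ae.
have [x0 [Ax0 _]] := closure_near Ay filterT.
have [ee _ _] := Ae _ Ax0.
have [n nA] : exists n, forall x, A x -> pw m n.+1 x = e.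
  have [n hn] := tame_bounded Qt ee; exists (n + n)%N => x /Ae[_ ex xe].
  by rewrite -(pwD mA) hn.
have ye : mul y (pwY n y) = h e.
  apply: closure_const => B /(@pwY_nbhs n.+1) /(closure_near Ay)[x [Ax Bx]].
  by exists (h e); split=> //; rewrite -(nA x Ax) h_pw.
have [U [V [yU yV UV]]] := mul_isolated ye.
have [w [Aw Vw]] := closure_near Ay (pwY_nbhs yV).
exists w; apply: closure_eq (closure_nearS Ay yU) _ => x [Ax Ux].
have [_ ex _] := Ae x Ax; have [_ ew _] := Ae w Aw.
have xw : m x (pw m n w) = e by apply: UV => //; rewrite h_pw.
by rewrite -ex mC -(nA w Aw) pwS (mC w) mA xw ew.
Qed.

(** Among the idempotents of the groups containing the values [q] a maximal one [d0] is taken,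
    attained at [g]. Near [y] maximality forces [q = g], whence [x * y], [y * y] and [x * x] all
    equal [g * g]; so these [x] share the group of [d0]. *)
Let closure_groups (A : set Q) (y : Y) : closure (h @` A) y ->
  (forall x, A x -> exists e, grp e x /\ exists q, mul (h e) y = h q) ->
  exists q, y = h q.
Proof.
move=> Ay Ae.
pose D := [set d | exists x e q,
  [/\ A x, grp e x, mul (h e) y = h q & grp d q]].
have near_grp x e q : A x -> grp e x -> mul (h e) y = h q ->
    exists2 V, nbhs y V & forall x', A x' -> V (h x') -> m e x' = q.
  move=> Ax ex eyq; have [U [V [eU yV UV]]] := mul_isolated eyq.
  by exists V => // x' _ Vx'; apply: UV => //; exact: nbhs_singleton eU.
have Dex x e q : A x -> grp e x -> mul (h e) y = h q -> exists d, grp d q.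
  move=> Ax ex eyq; have [V yV hV] := near_grp x e q Ax ex eyq.
  have [x' [Ax' Vx']] := closure_near Ay yV; have [e' [ex' _]] := Ae x' Ax'.
  exists (m e e'); rewrite -(hV x' Ax' Vx').
  by apply: in_group_mul => //; apply: in_group_self; case: ex.
have [d0 [[x0 [e0 [g [Ax0 e0x0 e0y d0g]]]] d0max]] : exists d, D d /\
    forall d', D d' -> m d' d = d -> d' = d.
  apply: (tame_max Qt); first by move=> d [x [e [q [_ _ _ []]]]].
  have [x [Ax _]] := closure_near Ay filterT; have [e [ex [q eyq]]] := Ae x Ax.
  by have [d dq] := Dex x e q Ax ex eyq; exists d, x, e, q.
have [V yV hV] := near_grp x0 e0 g Ax0 e0x0 e0y.
have [e0e0 _ _] := e0x0; have [d0d0 d0g' _] := d0g.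
have near_q x : A x -> V (h x) -> exists e,
    [/\ grp e x, mul (h e) y = h g & m x g = m g g].
  move=> Ax Vx; have [e [ex [q eyq]]] := Ae x Ax; exists e.
  have [d dq] := Dex x e q Ax ex eyq; have [ee ex' _] := ex.
  have xg := hV x Ax Vx.
  have d0E : d0 = m e0 e.
    apply: in_group_inj d0g _ => //; rewrite -xg.
    by apply: in_group_mul => //; exact: in_group_self.
  have eg : m e g = g by rewrite -xg mA (mC e) -mA ex'.
  have e0q : m e0 q = g.
    by apply: hI; rewrite hM -eyq mulYA -hM mC hM -mulYA e0y -hM eg.
  (* Since [e0 * q = g], the product [e0 * d] is [d0], so [d] is above [d0]. *)
  have dd0 : d = d0.
    apply: d0max; first by exists x, e, q.
    have : grp (m e0 d) g.
      by rewrite -e0q; apply: in_group_mul => //; exact: in_group_self.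
    move=> /(in_group_inj mA d0g) E; have [dd _ _] := dq.
    by rewrite E mC -mA dd.
  have [_ dq' _] := dq.
  have eq : m e q = q by apply: hI; rewrite hM -eyq mulYA -hM ee.
  have qg : q = g by rewrite -dq' dd0 d0E -mA eq.
  split=> //; first by rewrite eyq qg.
  have e0g : m e0 g = g by rewrite -{1}eg mA -d0E.
  by rewrite -{1}e0g mA (mC x) xg.
have near_mul x : A x -> V (h x) -> mul (h x) y = h (m g g).
  move=> Ax Vx; have [e [[_ ex _] eyg xg]] := near_q x Ax Vx.
  by rewrite -ex mC hM -mulYA eyg -hM xg.
have yy : mul y y = h (m g g).
  apply: closure_const => B /mul_nbhs[U [W [yU yW UW]]].
  have [x [Ax [Ux Vx]]] := closure_near Ay (filterI yU yV).
  exists (h (m g g)); split=> //; rewrite -(near_mul x Ax Vx).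
  by apply: UW => //; exact: nbhs_singleton yW.
have [U [W [yU yW UW]]] := mul_isolated yy.
apply: (@closure_group d0 _ _ (closure_nearS Ay (filterI (filterI yU yW) yV))).
move=> x [Ax [[Ux Wx] Vx]]; have [e [ex _ _]] := near_q x Ax Vx.
have [ee _ _] := ex.
have := in_group_mul mA mC d0g d0g; rewrite -(UW x x Ux Wx) d0d0.
by move/(in_group_inj mA (in_group_mul mA mC ex ex)) <-; rewrite ee.
Qed.

(** The nonregular part is finite, so [y] is a limit of elements of groups. If some idempotent keeps
    [y] outside, a minimal such [f] is used, and [f * y] takes the place of [y]. *)
Lemma tame_closed : closed (range h).
Proof.
move=> y yh; apply: contrapT => nyh.
pose reg := [set x | exists k, pw m k.+1 x = x].
have yreg : closure (h @` reg) y.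
  have E : range h = h @` reg `|` h @` (~` reg).
    by rewrite -image_setU setUv.
  move: yh; rewrite E closureU => -[//|].
  have fin : finite_set (h @` (~` reg)).
    apply: finite_image; apply: sub_finite_set (tame_nonregular Qt).
    by move=> x nx k xk; apply: nx; exists k.
  have [_ /accessible_finite_set_closed/(_ _ fin)/closure_id <-] := YT.
  by move=> [x _ xy]; case: nyh; exists x.
have reg_grp x : reg x -> exists e, grp e x.
  by move=> [k /(regular_in_group mA mC)]; exists (pw m k x).
pose N := [set f | m f f = f /\ forall q, mul (h f) y <> h q].
have [N0|Nne] := pselect (N !=set0); last first.
  have [q yq] : exists q, y = h q; last by apply: nyh; exists q.
  apply: (closure_groups yreg) => x /reg_grp[e ex]; exists e; split=> //.
  apply: contrapT => /forallNP nq; apply: Nne.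
  by exists e; split=> //; case: ex.
have [f [[ff fy] fmin]] : exists f, N f /\ forall a, N a -> m a f = a -> a = f.
  by apply: (tame_min Qt) => // a [].
have [[q E]|no] := pselect (exists q, mul (h f) y = h q); first exact: fy E.
have cl_f := @closure_mull _ _ f yreg.
(* Near [f * y] there are elements of the group of [f], or of groups of idempotents strictly below
   [f]; the latter bring [y] inside by minimality. *)
pose B1 := [set x | grp f x].
pose B2 := [set x | exists e, [/\ grp e x, m e f = e & e <> f]].
have : closure (h @` B1 `|` h @` B2) (mul (h f) y).
  rewrite -image_setU; apply: closureS cl_f => _ [_ [x /reg_grp[e ex] <-] <-].
  exists (m f x) => //; have fe : grp (m f e) (m f x).
    by apply: in_group_mul => //; exact: in_group_self.
  have [E|ne] := pselect (m f e = f); first by left; rewrite /B1 /= -{1}E.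
  by right; exists (m f e); split=> //; rewrite mC mA ff.
rewrite closureU => -[|] cl_B.
  by apply: no; exact: (@closure_group f _ _ cl_B).
apply: no; apply: (closure_groups cl_B) => x [e [ex ef nef]].
exists e; split=> //.
have -> : mul (h e) (mul (h f) y) = mul (h e) y by rewrite mulYA -hM ef.
apply: contrapT => /forallNP nq; apply: nef; apply: fmin => //.
by split=> //; case: ex.
Qed.

End Closedness.

Lemma tame_T1closed (Q : Type) (m : Q -> Q -> Q) : tame m -> C_closed T1S m.
Proof. by move=> Qt Y mul YT h hemb; exact: (tame_closed Qt YT hemb). Qed.

(** * The center and its quotients *)

Section TameImage.
Context (S Q : Type) (s : S -> S -> S) (m : Q -> Q -> Q) (p : S -> Q).
Hypotheses (St : tame s) (pM : forall x y, p (s x y) = m (p x) (p y)).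
Hypothesis p_surj : forall q, exists x, p x = q.

Let sA := tame_assoc St.
Let sC := tame_comm St.

Let p_pw k x : p (pw s k x) = pw m k (p x).
Proof. by elim: k => // k IH; rewrite !pwS pM IH. Qed.

Let mA : assoc_op m.
Proof.
move=> a b c; have [x <-] := p_surj a; have [y <-] := p_surj b.
by have [z <-] := p_surj c; rewrite -!pM sA.
Qed.

Let mC x y : m x y = m y x.
Proof.
by have [a <-] := p_surj x; have [b <-] := p_surj y; rewrite -!pM sC.
Qed.

Let idem_mul e f : s e e = e -> s f f = f -> s (s e f) (s e f) = s e f.
Proof.
by move=> ee ff; rewrite -sA (sA f) (sC f e) -(sA e f) ff sA ee.
Qed.

Let least f : Prop := s f f = f /\ forall e, s e e = e -> p e = p f -> s e f = f.

(** The idempotents over [q] are closed under products, so a minimal one is the least. Least lifts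
    carry the order of idempotents of [Q] back to [S]. *)
Let least_lift q : m q q = q -> exists f, p f = q /\ least f.
Proof.
move=> qq; pose A := [set e | s e e = e /\ p e = q].
have [||f [[ff fq] fmin]] := tame_min St (A := A); first by move=> a [].
  have [x xq] := p_surj q; have [k xk] := tame_periodic St x.
  by exists (pw s k x); split=> //; rewrite p_pw xq pw_idem.
exists f; split=> //; split=> // e ee ef.
apply: fmin; last by rewrite -sA ff.
by split; [exact: idem_mul|rewrite pM ef fq qq].
Qed.

Lemma tame_image : tame m.
Proof.
split=> //.
- move=> q; have [x <-] := p_surj q; have [k xk] := tame_periodic St x.
  by exists k; rewrite -p_pw -pM xk.
- move=> A Aidem [q Aq]; pose B := [set e | s e e = e /\ A (p e)].
  have [||f [[ff Af] fmin]] := tame_min St (A := B); first by move=> a [].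
    by have [f [fq [ff _]]] := least_lift (Aidem q Aq); exists f; rewrite /B /= fq.
  exists (p f); split=> // a Aa af.
  have [e [ea [ee _]]] := least_lift (Aidem a Aa).
  have E : s e f = f.
    apply: fmin; last by rewrite -sA ff.
    by split; [exact: idem_mul|rewrite pM ea af].
  by rewrite -af -ea -pM E.
- move=> A Aidem [q Aq]; pose B := [set e | least e /\ A (p e)].
  have [||f [[[ff fl] Af] fmax]] := tame_max St (A := B); first by move=> a [[]].
    by have [f [fq lf]] := least_lift (Aidem q Aq); exists f; rewrite /B /= fq.
  exists (p f); split=> // a Aa af.
  have [e [ea le]] := least_lift (Aidem a Aa); have [ee _] := le.
  have ef : s e f = f.
    have h : s (s e f) f = f.
      by apply: fl; [exact: idem_mul|rewrite pM ea af].
    by rewrite -sA ff in h.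
  by rewrite -ea (fmax e) // /B /= ea.
- move=> e ee; have [f [fe [ff fl]]] := least_lift ee.
  have [n fn] := tame_bounded St ff; exists n => q eq [k qk].
  have [x xq] := p_surj q.
  have fxq : p (s f x) = q by rewrite pM fe xq.
  rewrite -fxq -p_pw fn ?fe//; first by rewrite sA ff.
  (* The idempotent power [g] of [f * x] lies over [e] and below [f], so it equals [f] by leastness.
     Hence [f * x] is in the group of [f], whose exponent is bounded. *)
  have [l yl] := tame_periodic St (pw s k (s f x)).
  set g := pw s l (pw s k (s f x)) in yl *.
  have ge : p g = e by rewrite /g !p_pw fxq qk pw_idem.
  have gf : s g f = f by apply: fl => //; rewrite ge fe.
  have fg : s f g = g.
    have Cs z : central s z by move=> y; exact: sC.
    by rewrite /g !(pw_mul sA)// !(pw_idem _ ff) sA ff.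
  by exists (k.+1 * l.+1).-1; rewrite -(pwM sA) -/g -[RHS]gf sC fg.
- apply: sub_finite_set (finite_image p (tame_nonregular St)) => q qn.
  have [x xq] := p_surj q; exists x => // k xk; apply: (qn k).
  by rewrite -xq -p_pw xk.
Qed.

End TameImage.

Lemma tame_center (X : Type) (op : X -> X -> X) (opA : assoc_op op) :
  ideal_C_closed TzS op -> tame (center_mul opA).
Proof.
move=> Xcl; pose v (z : Defs.center op) := proj1_sig z.
have vI : injective v by move=> [a aZ] [b bZ] ab; exact: eq_exist.
have vM a b : v (center_mul opA a b) = op (v a) (v b) by [].
have v_pw k a : v (pw (center_mul opA) k a) = pw op k (v a).
  by elim: k => // k IH; rewrite !pwS vM IH.
have vZ a : central op (v a) := proj2_sig a.
pose R a b := [/\ central op a, central op b, op a b = a & a <> b].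
have Rt a b c : R a b -> R b c -> R a c.
  move=> [aZ bZ ab nab] [_ cZ bc nbc]; split=> //.
    by rewrite -ab -opA bc.
  by move=> ac; apply: nab; rewrite -ab aZ ac.
have Ri a : ~ R a a by case.
have RC a b : R a b ->
    (op a b = a \/ op a b = b) /\ (op b a = a \/ op b a = b).
  by move=> [aZ _ ab _]; split; left=> //; rewrite -aZ.
split.
- by move=> a b c; apply: vI; rewrite !vM opA.
- by move=> a b; apply: vI; rewrite !vM vZ.
- move=> a; have [k ak] := central_idempotent_power opA Xcl (vZ a).
  by exists k; apply: vI; rewrite vM v_pw.
- move=> A Aidem [a0 Aa0].
  have [||_ [[e Ae <-] emin]] :=
    central_idempotent_extremal opA Xcl (A := v @` A) Rt Ri RC.
  + by move=> _ [a Aa <-]; split; [exact: vZ|rewrite -vM Aidem].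
  + by exists (v a0), a0.
  exists e; split=> // a Aa ae; apply: contrapT => nae.
  apply: (emin (v a)); first by exists a.
  by split=> //; [rewrite -vM ae|move=> /vI].
- move=> A Aidem [a0 Aa0].
  have [|||||_ [[e Ae <-] emax]] :=
    central_idempotent_extremal opA Xcl (R := fun a b => R b a) (A := v @` A).
  + by move=> a b c ba cb; exact: Rt cb ba.
  + exact: Ri.
  + by move=> a b /RC[h1 h2]; split; [case: h2|case: h1] => ->; [right|left|right|left].
  + by move=> _ [a Aa <-]; split; [exact: vZ|rewrite -vM Aidem].
  + by exists (v a0), a0.
  exists e; split=> // a Aa ae; apply: contrapT => nae.
  apply: (emax (v a)); first by exists a.
  split=> //; first by rewrite vZ -vM ae.
  by move=> /vI /esym.
- move=> e ee; have ve : op (v e) (v e) = v e by rewrite -vM ee.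
  have [n hn] := central_bounded opA Xcl (vZ e) ve.
  exists n => x ex [k xk]; apply: vI; rewrite v_pw.
  have ex' : op (v e) (v x) = v x by rewrite -vM ex.
  rewrite /pw -(pow_atSr (vZ e))//; apply: hn; split=> //.
  by exists k; rewrite (pow_atSr (vZ e))// -/(pw op k _) -v_pw xk.
- have Nfin := central_nonregular_finite opA Xcl.
  have /= := @finite_preimage _ _ _ v (in2W vI) Nfin.
  apply: sub_finite_set => x xn /=; split=> // k xk; apply: (xn k).
  by apply: vI; exact: etrans (v_pw k.+1 x) xk.
Qed.

Theorem theorem1p13 (X : Type) (op : X -> X -> X) (Hassoc : assoc_op op) :
  Z_viable op -> ideal_C_closed TzS op ->
  proj_C_closed T1S (center_mul Hassoc).
Proof.
move=> _ Xcl E HE; apply: tame_T1closed.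
apply: (tame_image (tame_center Hassoc Xcl) (p := @quot_class _ E)).
  by move=> x y; rewrite quot_mul_class.
by move=> q; have [a ->] := quot_classP q; exists a.
Qed.
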